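(* For non-expanding dynamic network games, the dynamic reachability problem is PSPACE-hard.
   Context: A network is $G=(V,E,A,S,(P_a)_{a\in\Sigma})$: finite node set $V$, undirected edges $E$, active nodes $A\subseteq V$, strong nodes $S\subseteq A$, and a partition $(P_a)_{a\in\Sigma}$ of $V$ into label classes; weak nodes are those in $A\setminus S$; the network is connected if the subgraph induced by $A$ is connected. In a dynamic network game $(G,R)$ ($G$ initial network, $R$ finite rule set), Destructor and Constructor alternate, Destructor first, both may skip. Destructor deletes one weak node. Constructor applies one rule of $R$: relabeling rules $\langle a,b\to c,d\rangle$ (relabel adjacent active nodes labeled $a,b$ to $c,d$; possibly several relabelings per turn), movement rules $\langle a\xrightarrow{\text{move}}b\rangle$ (for adjacent $u\in S\cap P_a$, $v\in P_b\setminus S$: $S:=(S\setminus\{u\})\cup\{v\}$, $A:=A\cup\{v\}$), or creation rules (which add new nodes). A game is non-expanding if $R$ contains no creation rule. The dynamic reachability problem: given $(G,R)$ with $G$ disconnected, does Constructor have a strategy such that in every play consistent with it some network is connected? *)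

(* Defs.v *)
From Stdlib Require List.
From mathcomp Require Import all_boot.
Set Implicit Arguments. Unset Strict Implicit. Unset Printing Implicit Defensive.

(* Rules of a non-expanding game: relabeling and movement rules only
   (no creation rules). Labels are natural numbers; the label alphabet
   Sigma is the (finite) set of labels occurring in the instance. *)
Inductive rule : Type :=
| Relab of nat & nat & nat & nat   (* <a,b -> c,d> *)
| Move of nat & nat.               (* <a -move-> b> *)

(* A game instance (G,R): nodes are 0..gN-1, undirected edges gE, active
   nodes gA, strong nodes gS, label of node i is nth 0 glab i (this gives
   the partition into label classes), rule set gR. *)
Record game : Type := Game {
  gN : nat;
  gE : seq (nat * nat);
  gA : seq nat;
  gS : seq nat;
  glab : seq nat;
  gR : seq rule }.

Definition game_wf (G : game) : Prop :=
  [/\ all (fun e => (e.1 < gN G) && (e.2 < gN G)) (gE G),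
      all (fun v => v < gN G) (gA G),
      all (fun v => v \in gA G) (gS G) &
      size (glab G) = gN G].

(* A position (current network): node set V, active set A, strong set S,
   labelling. The edge relation is that of the initial network restricted
   to the surviving nodes (non-expanding games never add edges/nodes). *)
Record state : Type := State {
  sV : nat -> bool;
  sA : nat -> bool;
  sS : nat -> bool;
  slab : nat -> nat }.

Definition init_state (G : game) : state :=
  State (fun i => i < gN G) (fun i => i \in gA G) (fun i => i \in gS G)
        (fun i => nth 0 (glab G) i).

Definition adj (G : game) (s : state) (u v : nat) : bool :=
  [&& sV s u, sV s v & ((u, v) \in gE G) || ((v, u) \in gE G)].

Definition active_step (G : game) (s : state) (u v : nat) : Prop :=
  [&& sA s u, sA s v & adj G s u v].

Inductive active_path (G : game) (s : state) (u : nat) : nat -> Prop :=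
| ap_refl : active_path G s u u
| ap_step v w : active_path G s u v -> active_step G s v w ->
    active_path G s u w.

Definition connected (G : game) (s : state) : Prop :=
  forall u v, sA s u -> sA s v -> active_path G s u v.

Definition dmove (s s' : state) : Prop :=
  exists w, [/\ sA s w, ~~ sS s w &
    s' = State (fun x => sV s x && (x != w)) (fun x => sA s x && (x != w))
               (sS s) (slab s)].

Definition relab_move (G : game) (a b c d : nat) (s s' : state) : Prop :=
  exists P : seq (nat * nat),
    [/\ P != [::],
        uniq (unzip1 P ++ unzip2 P),
        all (fun p => [&& sA s p.1, sA s p.2, adj G s p.1 p.2,
                          slab s p.1 == a & slab s p.2 == b]) P &
        s' = State (sV s) (sA s) (sS s)
               (fun x => if x \in unzip1 P then c
                         else if x \in unzip2 P then d else slab s x)].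

Definition move_move (G : game) (a b : nat) (s s' : state) : Prop :=
  exists u v,
    [/\ sS s u /\ slab s u = a, ~~ sS s v /\ slab s v = b, adj G s u v &
        s' = State (sV s) (fun x => sA s x || (x == v))
                   (fun x => (sS s x && (x != u)) || (x == v)) (slab s)].

Definition apply_rule (G : game) (r : rule) (s s' : state) : Prop :=
  match r with
  | Relab a b c d => relab_move G a b c d s s'
  | Move a b => move_move G a b s s'
  end.

Definition cmove (G : game) (s s' : state) : Prop :=
  exists2 r, Stdlib.Lists.List.In r (gR G) & apply_rule G r s s'.

Definition cstrategy (G : game) (sigma : seq state -> state) : Prop :=
  forall h : seq state,
    let s := last (init_state G) h in sigma h = s \/ cmove G s (sigma h).

Definition consistent_play (G : game) (sigma : seq state -> state)
    (p : nat -> state) : Prop :=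
  [/\ p 0 = init_state G,
      forall i, p i.*2.+1 = p i.*2 \/ dmove (p i.*2) (p i.*2.+1) &
      forall i, p i.*2.+2 = sigma (map p (iota 0 i.*2.+2))].

Definition constructor_wins (G : game) : Prop :=
  exists2 sigma, cstrategy G sigma &
    forall p, consistent_play G sigma p -> exists i, connected G (p i).

Definition dr_promise (G : game) : Prop :=
  game_wf G /\ ~ connected G (init_state G).

(* Deterministic single-tape TM; states 0..tm_nq-1 (start 0); tape
   symbols 0..tm_ns-1, with 0 = blank, 1 = bit false, 2 = bit true.
   tm_delta q a = None means halt; Some (q', b, right) writes b, enters q'
   and moves right (if right) or left. *)
Record TM : Type := MkTM {
  tm_nq : nat;
  tm_ns : nat;
  tm_delta : nat -> nat -> option (nat * nat * bool);
  tm_acc : nat -> bool }.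

Definition tm_wf (M : TM) : Prop :=
  [/\ 0 < tm_nq M, 3 <= tm_ns M &
      forall q a, q < tm_nq M -> a < tm_ns M ->
        forall q' b d, tm_delta M q a = Some (q', b, d) ->
          q' < tm_nq M /\ b < tm_ns M].

(* configuration: state, reversed left part, scanned symbol, right part *)
Definition config := (nat * seq nat * nat * seq nat)%type.

Definition tm_step (M : TM) (c : config) : option config :=
  let: (q, L, a, R) := c in
  match tm_delta M q a with
  | None => None
  | Some (q', b, true) => Some (q', b :: L, head 0 R, behead R)
  | Some (q', b, false) => Some (q', behead L, head 0 L, b :: R)
  end.

Fixpoint tm_exec (M : TM) (n : nat) (c : config) : option config :=
  match n with
  | 0 => Some c
  | n'.+1 => match tm_step M c with
             | None => None
             | Some c' => tm_exec M n' c'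
             end
  end.

Definition bit_sym (b : bool) : nat := if b then 2 else 1.

Definition tm_init (x : seq bool) : config :=
  let t := map bit_sym x in (0, [::], head 0 t, behead t).

Definition cfg_state (c : config) : nat := c.1.1.1.
Definition cfg_space (c : config) : nat := size c.1.1.2 + size c.2 + 1.

Fixpoint read_bits (t : seq nat) : seq bool :=
  match t with
  | 1 :: t' => false :: read_bits t'
  | 2 :: t' => true :: read_bits t'
  | _ => [::]
  end.

Definition cfg_output (c : config) : seq bool := read_bits (c.1.2 :: c.2).

Definition in_PSPACE (L : seq bool -> Prop) : Prop :=
  exists M, tm_wf M /\ exists k, forall x,
    exists n c, [/\ tm_exec M n (tm_init x) = Some c,
                    tm_step M c = None,
                    (tm_acc M (cfg_state c) <-> L x) &
                    forall m c', m <= n -> tm_exec M m (tm_init x) = Some c' ->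
                      cfg_space c' <= size x ^ k + k].

Definition poly_time (f : seq bool -> seq bool) : Prop :=
  exists M, tm_wf M /\ exists k, forall x,
    exists n c, [/\ n <= size x ^ k + k,
                    tm_exec M n (tm_init x) = Some c,
                    tm_step M c = None &
                    cfg_output c = f x].

Definition enc_nat (n : nat) : seq bool := rcons (nseq n true) false.

Definition rule_nats (r : rule) : seq nat :=
  match r with
  | Relab a b c d => [:: 0; a; b; c; d]
  | Move a b => [:: 1; a; b]
  end.

Definition game_nats (G : game) : seq nat :=
  [:: gN G; size (gE G)] ++ flatten (map (fun e => [:: e.1; e.2]) (gE G))
  ++ (size (gA G) :: gA G) ++ (size (gS G) :: gS G)
  ++ (size (glab G) :: glab G)
  ++ (size (gR G) :: flatten (map rule_nats (gR G))).

Definition enc_game (G : game) : seq bool := flatten (map enc_nat (game_nats G)).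

Definition PSPACE_hard (Yes Promise : game -> Prop) : Prop :=
  forall L : seq bool -> Prop, in_PSPACE L ->
    exists f : seq bool -> game,
      poly_time (fun x => enc_game (f x)) /\
      forall x, Promise (f x) /\ (L x <-> Yes (f x)).

(* Main.v *)
From Stdlib Require List Classical ClassicalEpsilon.
Require Import Defs.
From mathcomp Require Import all_boot.
From mathcomp Require Import zify.
Set Implicit Arguments. Unset Strict Implicit. Unset Printing Implicit Defensive.

(** A polynomial-space machine [M] is simulated by relabelings alone, so that
    Destructor never gets to act.  The tape is a path of strong nodes on which
    exactly one node carries a head label; every tape cell occupies three
    consecutive nodes, because an undirected edge does not tell left from right
    but the cyclic order "symbol, R, S" does.  The head label makes Constructor's
    move essentially unique.  Besides the path there is an isolated strong node
    and an inactive bridge node adjacent to everything: a movement rule onto the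
    bridge exists exactly for the halting accepting head labels, and the network
    is connected as soon as that rule is applied.

    The encoding of this game is written by a queue machine run on a Turing tape:
    pop a symbol at the front, append a word at the back.  Its programs iterate
    letter-to-word substitutions, as many times as there are symbols of a given
    class on the tape.  With [U -> U V] this multiplies a block length by
    [n + 2], hence yields [(n + 2)^(k + 1)] blanks; with [Z -> Z 1 1 b] and
    [b -> 1 b] it writes the unary numbers [2, 3, 4, ...] in a row.  Substitutions
    never erase, so the running time is polynomial in the length of the output. *)

(** * The path game *)

(** Sealed by [Qed], so that no label is ever computed to a large unary numeral. *)
Lemma label_coding :
  {f : nat * nat * nat -> nat & {g : nat -> nat * nat * nat | cancel f g}}.
Proof.
exists pickle, (fun n => odflt (0, 0, 0) (unpickle n)) => t.
by rewrite pickleK.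
Qed.

Definition lbl (k q a : nat) : nat := tag label_coding (k, q, a).
Definition unlbl (l : nat) : nat * nat * nat := sval (tagged label_coding) l.
Definition kind (l : nat) : nat := (unlbl l).1.1.

Lemma lblK k q a : unlbl (lbl k q a) = (k, q, a).
Proof. exact: (svalP (tagged label_coding)). Qed.

Lemma kind_lbl k q a : kind (lbl k q a) = k.
Proof. by rewrite /kind lblK. Qed.

Lemma lbl_inj k q a k' q' a' :
  lbl k q a = lbl k' q' a' -> [/\ k = k', q = q' & a = a'].
Proof. by move=> /(congr1 unlbl); rewrite !lblK => -[-> -> ->]. Qed.

(* [lW] isolated node, [lB] bridge; [lA a], [lR], [lS] the three nodes of a cell
   holding [a]; [hA q a] head in state [q] scanning [a]; [hRr], [hSr] (resp.
   [hSl], [hRl]) head in transit to the right (resp. left) through R and S. *)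
Definition lW := lbl 0 0 0.
Definition lB := lbl 1 0 0.
Definition lR := lbl 2 0 0.
Definition lS := lbl 3 0 0.
Definition lA a := lbl 4 0 a.
Definition hA q a := lbl 5 q a.
Definition hRr q := lbl 6 q 0.
Definition hSr q := lbl 7 q 0.
Definition hSl q := lbl 8 q 0.
Definition hRl q := lbl 9 q 0.

Definition is_head l := 5 <= kind l.
Definition is_idle l := 2 <= kind l < 5.

(** A relabeling turns a head and an idle neighbour into an idle node and a head, so exactly one
    head persists. Isolated node and bridge are neither head nor idle and keep their labels. *)
Definition rules_ok (R : seq rule) : Prop := forall r, List.In r R ->
  match r with
  | Relab a b c d => [/\ is_head a, is_idle b, is_idle c & is_head d]
  | Move a b => is_head a /\ b = lB
  end.

(** * Runs of a single head on a labelled path *)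

Notation zipper := (seq nat * nat * seq nat)%type.

Definition zlist (z : zipper) : seq nat := rev z.1.1 ++ z.1.2 :: z.2.

Definition zipper_ok (z : zipper) : bool :=
  [&& all is_idle z.1.1, is_head z.1.2 & all is_idle z.2].

Definition zstep (R : seq rule) (z z' : zipper) : Prop :=
  exists b c d, List.In (Relab z.1.2 b c d) R /\
    ((z.2 = b :: z'.2 /\ z'.1 = (c :: z.1.1, d)) \/
     (z.1.1 = b :: z'.1.1 /\ (z'.1.2, z'.2) = (d, c :: z.2))).

Definition zmove (R : seq rule) (z : zipper) : Prop :=
  List.In (Move z.1.2 lB) R.

Inductive zrun (R : seq rule) : zipper -> bool -> Prop :=
| zrun_acc z : zmove R z -> (forall z', ~ zstep R z z') -> zrun R z true
| zrun_rej z : ~ zmove R z -> (forall z', ~ zstep R z z') -> zrun R z false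
| zrun_step z z' b : ~ zmove R z -> zstep R z z' ->
    (forall z'', zstep R z z'' -> z'' = z') -> zrun R z' b -> zrun R z b.

Lemma zrun_false_step R z z' :
  zrun R z false -> zstep R z z' -> zrun R z' false.
Proof.
move=> H Hst; inversion H as [|? _ Hn|? z1 b _ _ Hu Hz1]; first by case: (Hn _ Hst).
by rewrite (Hu _ Hst).
Qed.

Lemma zrun_false_nmove R z : zrun R z false -> ~ zmove R z.
Proof. by move=> H; inversion H. Qed.

(** Node 0 hangs on the bridge 1, and [i.+2] is position [i] of the path. For [i = 0] both listed
    edges are [(2, 1)]; the repetition keeps a uniform two edges per position. *)
Definition path_edges (T : nat) : seq (nat * nat) :=
  (0, 1) :: flatten [seq [:: (i.+2, i.+1); (i.+2, 1)] | i <- iota 0 T].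

Definition path_active (T : nat) : seq nat := 0 :: [seq i.+2 | i <- iota 0 T].

Arguments path_edges : simpl never.
Arguments path_active : simpl never.

Definition path_game (l : seq nat) (R : seq rule) : game :=
  let T := size l in
  Game T.+2 (path_edges T) (path_active T) (path_active T) [:: lW, lB & l] R.

Lemma mem_path_active T x : (x \in path_active T) = (x == 0) || (1 < x < T.+2).
Proof.
rewrite inE; case: x => [|[|x]] //=; last first.
  by rewrite mem_map ?mem_iota // => i j [].
by apply/mapP=> -[].
Qed.

Lemma mem_path_edges T u v :
  ((u, v) \in path_edges T) =
  ((u == 0) && (v == 1)) || [&& 1 < u < T.+2 & (v == u.-1) || (v == 1)].
Proof.
rewrite inE xpair_eqE; congr (_ || _).
apply/flatten_mapP/idP => [[i]|].
  by rewrite mem_iota !inE !xpair_eqE; lia.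
case: u => [|[|u]] //= /andP[Hu Hv]; exists u; first by rewrite mem_iota.
by rewrite !inE !xpair_eqE; lia.
Qed.

Lemma path_game_wf l R : game_wf (path_game l R).
Proof.
split; rewrite ?[gE _]/(path_edges _) ?[gA _]/(path_active _)
  ?[gS _]/(path_active _) //.
- by apply/allP => -[u v]; rewrite mem_path_edges /=; lia.
- by apply/allP => u; rewrite mem_path_active /=; lia.
Qed.

(** * The invariant linking positions of the game to zippers *)

Record inv (z : zipper) (s : state) : Prop := Inv {
  inv_ok : zipper_ok z;
  inv_V : forall x, sV s x = (x < (size (zlist z)).+2);
  inv_A : forall x, sA s x = (x == 0) || (1 < x < (size (zlist z)).+2);
  inv_S : forall x, sS s x = (x == 0) || (1 < x < (size (zlist z)).+2);
  inv_lab : forall x, x < (size (zlist z)).+2 ->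
    slab s x = nth 0 [:: lW, lB & zlist z] x }.

Lemma inv_init z R : zipper_ok z -> inv z (init_state (path_game (zlist z) R)).
Proof.
by move=> Hz; split=> //= x; rewrite mem_path_active.
Qed.

Lemma inv_adj z s l R x y : inv z s -> size l = size (zlist z) ->
  adj (path_game l R) s x y =
   [|| (x == 0) && (y == 1), (y == 0) && (x == 1),
      [&& 1 < x < (size l).+2 & (y == x.-1) || (y == 1)] |
      [&& 1 < y < (size l).+2 & (x == y.-1) || (x == 1)] ].
Proof.
move=> I E; rewrite /adj !(inv_V I) /= !mem_path_edges E; lia.
Qed.

(** Node 0 has only the bridge as neighbour, and the bridge is inactive, so an active path from 0
    never leaves 0. *)
Lemma inv_not_connected z s l R : inv z s -> size l = size (zlist z) ->
  ~ connected (path_game l R) s.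
Proof.
move=> I E /(_ 0 2); rewrite !(inv_A I) /= /zlist size_cat /= addnS.
move=> /(_ isT isT) H.
suff : 2 = 0 by [].
elim: H => // v w _ -> /and3P[_].
by rewrite (inv_A I) (inv_adj _ _ _ I E); lia.
Qed.

(** A deletable node is active and weak, but the invariant describes [sA] and [sS] by the same
    formula. *)
Lemma inv_no_dmove z s s' : inv z s -> ~ dmove s s'.
Proof. by move=> I [w [+ + _]]; rewrite (inv_A I) (inv_S I) => ->. Qed.

Lemma size_zlist z : size (zlist z) = (size z.1.1 + size z.2).+1.
Proof. by rewrite /zlist size_cat size_rev /= addnS. Qed.

Lemma nth_zlist_head z : nth 0 (zlist z) (size z.1.1) = z.1.2.
Proof. by rewrite /zlist nth_cat size_rev ltnn subnn. Qed.

Lemma nth_zlist_head_idle z i : zipper_ok z -> i < size (zlist z) ->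
  i != size z.1.1 -> is_idle (nth 0 (zlist z) i).
Proof.
case/and3P=> H1 _ H2; rewrite size_zlist => Hi Hn.
rewrite /zlist nth_cat size_rev; case: ltnP => Hlt.
  by rewrite -all_rev in H1; apply: (allP H1); apply: mem_nth; rewrite size_rev.
have {}Hlt : size z.1.1 < i by rewrite ltn_neqAle eq_sym Hn.
rewrite -(subnSK Hlt) /=.
have H3 : i - (size z.1.1).+1 < size z.2 by rewrite ltn_subLR // addSn.
by apply: (allP H2); apply: mem_nth.
Qed.

Lemma inv_headP z s x : inv z s -> sA s x -> is_head (slab s x) ->
  x = (size z.1.1).+2.
Proof.
move=> I; rewrite (inv_A I) => /orP[/eqP->|Hx].
  by rewrite (inv_lab I) //= /is_head kind_lbl.
rewrite (inv_lab I) ?(andP Hx).2 //; case: x Hx => [|[|x]] //= Hx.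
case: (x =P size z.1.1) => [-> //|/eqP Hn].
have := nth_zlist_head_idle (inv_ok I) Hx Hn; rewrite /is_head /is_idle; lia.
Qed.

Lemma inv_lab_head z s : inv z s -> slab s (size z.1.1).+2 = z.1.2.
Proof.
move=> I; rewrite (inv_lab I) /= ?nth_zlist_head // size_zlist; lia.
Qed.

(* Only the unique head can be the first component of a relabelled pair. *)
Lemma inv_relab z s s' l R a b c d : rules_ok R -> inv z s ->
  size l = size (zlist z) -> List.In (Relab a b c d) R ->
  relab_move (path_game l R) a b c d s s' ->
  exists2 z', zstep R z z' & inv z' s' /\ size (zlist z') = size (zlist z).
Proof.
move=> HR I E Hin [P [Pn Pu Pa ->]].
have [ha ib ic hd] := HR _ Hin.
have P1 p : p \in P -> p.1 = (size z.1.1).+2.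
  move=> /(allP Pa)/and5P[Ap _ _ /eqP lp _].
  by apply: (inv_headP I); rewrite ?lp.
(* Two pairs would share the head as first component, against [uniq]. *)
case: P Pn Pu Pa P1 => [//|p [|p2 P]] _ /= Pu Pa P1; last first.
  have := P1 p (mem_head _ _); have := P1 p2.
  rewrite inE mem_head orbT => /(_ isT) e2 e1.
  by move: Pu; rewrite e1 e2 /= inE eqxx.
move: Pa; rewrite andbT => /and5P[A1 A2 ad /eqP l1 /eqP l2].
have e1 : p.1 = (size z.1.1).+2 by apply: P1; rewrite inE.
move: ad; rewrite (inv_adj _ _ _ I E) E => ad.
have lh := inv_lab_head I; rewrite -e1 l1 in lh.
move: A2 A1; rewrite !(inv_A I) => A2 A1.
have l2' := l2; rewrite (inv_lab I) in l2'; last by lia.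
case: p A1 A2 e1 ad l1 l2 l2' {P1 Pu} => [u v] /=.
case: z I E lh => [[ru h] rv] I E /= lh.
move=> A1 A2 e1 ad l1 l2 l2'; subst a u.
have [Hz HV HA HS HL] := I.
move: Hz => /and3P[/= H1 H2 H3].
move: (size_zlist (ru, h, rv)) => /= sz.
(* The bridge is inactive, so [v] is the next or the previous node of the path. *)
have [ev|ev] : v = (size ru).+3 \/ v = (size ru).+1 /\ 0 < size ru by lia.
- subst v; move: l2'; rewrite /= {1}/zlist nth_cat size_rev /=.
  rewrite ltnNge leqnSn /= subSnn /=.
  case: rv I E sz H3 HV HA HS HL A1 A2 ad
    => [|b' rv] I E sz H3 HV HA HS HL A1 A2 ad /=.
    by move: sz A2 => /= ->; lia.
  move=> eb; subst b'.
  exists (c :: ru, d, rv).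
    by exists b, c, d; split=> //; left.
  have sz' : size (zlist (c :: ru, d, rv)) = size (zlist (ru, h, b :: rv)).
    by rewrite !size_zlist /=; lia.
  split=> //; split=> /=; rewrite ?sz' //.
    by apply/and3P; split=> //=; [rewrite ic | case/andP: H3].
  move=> x Hx; rewrite !inE (HL _ Hx).
  case: x Hx => [|[|x]] //= Hx; rewrite !eqSS /zlist /= rev_cons cat_rcons.
  rewrite !nth_cat size_rev; case: ltnP => Hlt; first by rewrite !ifN //; lia.
  case: eqP => [->|ne]; first by rewrite subnn.
  case: eqP => [->|ne']; first by rewrite subSnn.
  have -> : x - size ru = (x - size ru - 2).+2 by lia.
  by [].
- case: ev => ev s0; subst v.
  case: ru I E sz H1 HV HA HS HL l1 l2 s0 A1 A2 ad l2'
    => [|b' ru] I E sz H1 HV HA HS HL l1 l2 s0 A1 A2 ad //= l2'.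
  have {l2'} eb : b' = b.
    rewrite -l2' /zlist /= rev_cons cat_rcons nth_cat size_rev ltnn subnn //.
  subst b'.
  exists (ru, d, c :: rv).
    by exists b, c, d; split=> //; right.
  have sz' : size (zlist (ru, d, c :: rv)) = size (zlist (b :: ru, h, rv)).
    by rewrite !size_zlist /=; lia.
  split=> //; split=> /=; rewrite ?sz' //.
    by apply/and3P; split=> //=; [case/andP: H1 | rewrite ic].
  move=> x Hx; rewrite !inE (HL _ Hx).
  case: x Hx => [|[|x]] //= Hx; rewrite !eqSS /zlist /= rev_cons cat_rcons.
  rewrite !nth_cat size_rev; case: ltnP => Hlt; first by rewrite !ifN //; lia.
  case: eqP => [->|ne]; first by rewrite subSnn.
  case: eqP => [->|ne']; first by rewrite subnn.
  have -> : x - size ru = (x - size ru - 2).+2 by lia.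
  by [].
Qed.

(** Only the bridge is not strong, so it is the target; once active it links any two nodes. *)
Lemma inv_move z s s' l R a : inv z s -> is_head a ->
  size l = size (zlist z) ->
  move_move (path_game l R) a lB s s' -> z.1.2 = a /\ connected (path_game l R) s'.
Proof.
move=> I ha E [u [v [[Su lu] [Sv lv] ad ->]]].
have Au : sA s u by rewrite (inv_A I) -(inv_S I).
have eu : u = (size z.1.1).+2 by apply: (inv_headP I); rewrite ?lu.
split; first by rewrite -(inv_lab_head I) -eu.
move: Sv ad; rewrite (inv_S I) (inv_adj _ _ _ I E) => Sv ad.
have ev : v = 1 by lia.
subst v; set s1 := State _ _ _ _.
have A1 x : sA s1 x = (x < (size (zlist z)).+2).
  by rewrite /= (inv_A I); lia.
have toB x : sA s1 x -> x != 1 -> active_step (path_game l R) s1 x 1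
    /\ active_step (path_game l R) s1 1 x.
  rewrite /active_step !A1 /adj /= !(inv_V I) !mem_path_edges E; lia.
move=> x y Ax Ay.
have P1 : active_path (path_game l R) s1 x 1.
  case: (x =P 1) => [->|/eqP ne]; first exact: ap_refl.
  exact: ap_step (ap_refl _ _ _) (toB _ Ax ne).1.
case: (y =P 1) => [->//|/eqP ne].
exact: ap_step P1 (toB _ Ay ne).2.
Qed.

Lemma inv_cmove z s s' l R : rules_ok R -> inv z s ->
  size l = size (zlist z) -> cmove (path_game l R) s s' ->
  (exists2 z', zstep R z z' & inv z' s' /\ size (zlist z') = size (zlist z)) \/
  (zmove R z /\ connected (path_game l R) s').
Proof.
move=> HR I E [[a b c d|a b] /= Hin Hm].
  by left; apply: inv_relab Hm.
have [ha eb] := HR _ Hin; subst b.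
by right; have [ez ?] := inv_move I ha E Hm; rewrite /zmove ez.
Qed.

(** Existence of some move suffices: [inv_cmove] identifies the effect of whichever move is made. *)
Lemma cmove_zstep z z' s l R : inv z s -> size l = size (zlist z) ->
  zstep R z z' -> exists s', cmove (path_game l R) s s'.
Proof.
move=> I E [b [c [d [Hin Hz]]]].
pose u := (size z.1.1).+2.
have [v [Av Huv lv]] : exists v, [/\ sA s v, (v == u.+1) || (u == v.+1) && (2 < u) &
     slab s v = b].
  case: Hz => -[e1 e2].
    exists u.+1; rewrite eqxx.
    have Hs : u.+1 < (size (zlist z)).+2 by rewrite size_zlist e1 /=; lia.
    rewrite (inv_A I) (inv_lab I) // Hs; split=> //=.
    by rewrite /zlist nth_cat size_rev ltnNge leqnSn /= subSnn /= e1.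
  exists u.-1; rewrite (inv_A I).
  have Hs : u < (size (zlist z)).+2 by rewrite size_zlist; lia.
  rewrite (inv_lab I); last by lia.
  rewrite /u e1 /= in Hs *; split; try lia.
  by rewrite /zlist e1 rev_cons cat_rcons nth_cat size_rev ltnn subnn.
pose s' := State (sV s) (sA s) (sS s) (fun x => if x \in [:: u] then c
                         else if x \in [:: v] then d else slab s x).
exists s', (Relab z.1.2 b c d) => //; exists [:: (u, v)]; split=> //=.
  by rewrite inE andbT; lia.
have Au : sA s u by rewrite (inv_A I) size_zlist; lia.
rewrite Au Av (inv_adj _ _ _ I E) /= (inv_lab_head I) lv !eqxx !andbT E.
by move: Au Av Huv; rewrite !(inv_A I); lia.
Qed.

Lemma cmove_zmove z s l R : inv z s -> size l = size (zlist z) ->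
  zmove R z -> exists s', cmove (path_game l R) s s'.
Proof.
move=> I E Hin; pose u := (size z.1.1).+2.
eexists; exists (Move z.1.2 lB) => //; exists u, 1; split=> //.
- by rewrite (inv_S I) (inv_lab_head I); split=> //; rewrite size_zlist; lia.
- by rewrite (inv_S I) (inv_lab I).
- by rewrite (inv_adj _ _ _ I E) E size_zlist; lia.
Qed.

(** * From the outcome of the run to the outcome of the game *)

Section Play.
Variables (z0 : zipper) (R : seq rule).
Hypotheses (HR : rules_ok R) (Hz0 : zipper_ok z0).
Let G := path_game (zlist z0) R.

Lemma last_history (p : nat -> state) i s0 :
  last s0 (map p (iota 0 i.*2.+2)) = p i.*2.+1.
Proof. by rewrite -[i.*2.+2]addn1 iotaD map_cat last_cat. Qed.

(* Any strategy that moves whenever it can wins: its moves are forced. *)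
Lemma zrun_true_wins : zrun R z0 true -> constructor_wins G.
Proof.
move=> Hrun.
have [sig Hsig] : exists sig : state -> state, forall s,
    cmove G s (sig s) \/ (sig s = s /\ forall s', ~ cmove G s s').
  apply: (ClassicalEpsilon.choice
    (fun s t => cmove G s t \/ (t = s /\ forall s', ~ cmove G s s'))).
  move=> s; case: (Classical_Prop.classic (exists s', cmove G s s')) => [[s' Hs]|H].
    by exists s'; left.
  by exists s; right; split=> // s' Hs; apply: H; exists s'.
exists (fun h => sig (last (init_state G) h)).
  by move=> h /=; case: (Hsig (last (init_state G) h)) => [|[]]; [right | left].
move=> p [p0 pD pC].
suff H z : zrun R z true -> forall i, inv z (p i.*2) ->
    size (zlist z) = size (zlist z0) -> exists i, connected G (p i).
  by apply: (H _ Hrun 0) => //; rewrite p0; apply: inv_init.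
have pS i z1 : inv z1 (p i.*2) -> p i.*2.+2 = sig (p i.*2).
  move=> I; rewrite pC last_history.
  by case: (pD i) => [->//|/(inv_no_dmove I)].
move=> Hz; move: {1 2}true Hz (erefl true) => b.
elim {b z} => [z Hm Hn _|z _ _ //|z z' b Hm Hst Hu _ IH /IH {}IH] i I E.
- exists i.*2.+2; rewrite (pS _ _ I).
  case: (Hsig (p i.*2)) => [Hc|[_ Hc]].
    by case: (inv_cmove HR I (esym E) Hc) => [[z' /Hn]|[]].
  by have [s' /Hc] := cmove_zmove I (esym E) Hm.
- apply: (IH i.+1); rewrite ?doubleS ?(pS _ _ I).
    case: (Hsig (p i.*2)) => [Hc|[_ Hc]].
      by case: (inv_cmove HR I (esym E) Hc) => [[z'' /Hu-> []]|[]].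
    by have [s' /Hc] := cmove_zstep I (esym E) Hst.
  case: (Hsig (p i.*2)) => [Hc|[_ Hc]].
    by case: (inv_cmove HR I (esym E) Hc) => [[z'' /Hu-> []]|[]] // _ ->.
  by have [s' /Hc] := cmove_zstep I (esym E) Hst.
Qed.

(** Destructor skips forever. Constructor can then only wait or follow the forced run, and every
    position reached satisfies [inv], hence is disconnected. *)
Lemma zrun_false_loses : zrun R z0 false -> ~ constructor_wins G.
Proof.
move=> Hrun [sigma Hsig Hwin].
pose s0 := init_state G.
(* [hist i] is the play after [i] rounds, of length [2 * i + 1]; the inner [rcons] repeats the last
   position for the skip. *)
pose fix hist i := if i is i'.+1 then
     let h' := rcons (hist i') (last s0 (hist i')) in rcons h' (sigma h')
   else [:: s0].
pose p i := nth s0 (hist i) i.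
have szh i : size (hist i) = i.*2.+1.
  by elim: i => //= i IH; rewrite !size_rcons IH doubleS.
have hstab i e j : j <= i.*2 -> nth s0 (hist (i + e)) j = nth s0 (hist i) j.
  move=> Hj; elim: e => [|e IH]; rewrite ?addn0 // addnS /=.
  by rewrite !nth_rcons !size_rcons szh !ifT ?IH //; lia.
have pE i j : j <= i.*2 -> nth s0 (hist i) j = p j.
  move=> Hj; rewrite /p; have [Hij|Hij] := leqP i j.
    by rewrite -(subnKC Hij) hstab //; lia.
  by rewrite -{1}(subnKC (ltnW Hij)) hstab //; lia.
have histE i : hist i = map p (iota 0 i.*2.+1).
  apply: (@eq_from_nth _ s0); first by rewrite szh size_map size_iota.
  move=> j; rewrite szh => Hj.
  by rewrite (nth_map 0) ?size_iota // nth_iota // pE.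
have p0 : p 0 = s0 by [].
have pD i : p i.*2.+1 = p i.*2.
  rewrite -(@pE i.+1); last by lia.
  rewrite /= !nth_rcons !size_rcons szh ltnSn ltnn eqxx.
  by rewrite (last_nth s0) szh /= -(pE i).
have hS i : rcons (hist i) (last s0 (hist i)) = map p (iota 0 i.*2.+2).
  have -> : last s0 (hist i) = p i.*2.+1 by rewrite (last_nth s0) szh /= pE.
  rewrite histE.
  by rewrite -[i.*2.+2]addn1 iotaD map_cat cats1.
have pC i : p i.*2.+2 = sigma (map p (iota 0 i.*2.+2)).
  rewrite -hS -(@pE i.+1); last by lia.
  by rewrite /= nth_rcons !size_rcons szh ltnn eqxx.
have [i Hi] : exists i, connected G (p i).
  by apply: Hwin; split=> // i; left.
have Hinv j : exists2 z, zrun R z false &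
    inv z (p j.*2) /\ size (zlist z) = size (zlist z0).
  elim: j => [|j [z Hz [I E]]].
    by exists z0 => //; split=> //; rewrite p0; apply: inv_init.
  rewrite doubleS pC.
  have := Hsig (map p (iota 0 j.*2.+2)); cbv zeta.
  rewrite last_history pD => -[->|Hc].
    by exists z.
  case: (inv_cmove HR I (esym E) Hc) => [[z' Hst [I' E']]|[Hm _]].
    exists z'; last by rewrite E'.
    exact: zrun_false_step Hz Hst.
  by case: (zrun_false_nmove Hz Hm).
have [z _ [I E]] := Hinv i./2.
have Hnc := inv_not_connected (R := R) I (esym E); apply: Hnc.
move: Hi; rewrite -{1}(odd_double_half i).
by case: (odd i); rewrite ?add1n ?add0n ?pD.
Qed.
End Play.

(** * Simulating a Turing machine by relabelings *)

(** A head leaves its cell rightwards through its own R and S, leftwards through the S and R of the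
    previous cell. Which of the two it meets first tells the directions apart, and each label is
    restored behind it. *)
Definition rules_at (M : TM) (q a : nat) : seq rule :=
  (match tm_delta M q a with
   | Some (q', b, true) => [:: Relab (hA q a) lR (lA b) (hRr q')]
   | Some (q', b, false) => [:: Relab (hA q a) lS (lA b) (hSl q')]
   | None => if tm_acc M q then [:: Move (hA q a) lB] else [::]
   end) ++
  [:: Relab (hRr q) lS lR (hSr q); Relab (hSr q) (lA a) lS (hA q a);
      Relab (hSl q) lR lS (hRl q); Relab (hRl q) (lA a) lR (hA q a)].

Definition tm_rules (M : TM) : seq rule :=
  flatten [seq rules_at M p.1 p.2
    | p <- [seq (q, a) | q <- iota 0 (tm_nq M), a <- iota 0 (tm_ns M)]].

Lemma In_cat (T : Type) (x : T) s t :
  List.In x (s ++ t) <-> List.In x s \/ List.In x t.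
Proof. by elim: s => [|y s IH] /=; [tauto | rewrite IH; tauto]. Qed.

Lemma In_flatten_map (I : eqType) (T : Type) (x : T) (f : I -> seq T) s :
  List.In x (flatten (map f s)) <-> exists2 i, i \in s & List.In x (f i).
Proof.
elim: s => [|i s IH] /=; first by split=> // -[].
rewrite In_cat IH; split=> [[Hx|[j js Hx]]|[j]].
- by exists i; rewrite // mem_head.
- by exists j; rewrite // inE js orbT.
- by rewrite inE => /orP[/eqP->|js] Hx; [left | right; exists j].
Qed.

Lemma tm_rulesP M r : List.In r (tm_rules M) <->
  exists q a, [/\ q < tm_nq M, a < tm_ns M & List.In r (rules_at M q a)].
Proof.
rewrite /tm_rules In_flatten_map.
split=> [[p /allpairsP[[q a] [/= Hq Ha ->]] Hr]|[q [a [Hq Ha Hr]]]].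
  by exists q, a; split=> //; [move: Hq | move: Ha]; rewrite mem_iota.
by exists (q, a) => //; apply/allpairsP; exists (q, a); rewrite !mem_iota.
Qed.

Variant relab_spec (M : TM) : nat -> nat -> nat -> nat -> Prop :=
| relab_right q a q' b of q < tm_nq M & a < tm_ns M
    & tm_delta M q a = Some (q', b, true) :
    relab_spec M (hA q a) lR (lA b) (hRr q')
| relab_left q a q' b of q < tm_nq M & a < tm_ns M
    & tm_delta M q a = Some (q', b, false) :
    relab_spec M (hA q a) lS (lA b) (hSl q')
| relab_Rr q of q < tm_nq M : relab_spec M (hRr q) lS lR (hSr q)
| relab_Sr q a of q < tm_nq M & a < tm_ns M :
    relab_spec M (hSr q) (lA a) lS (hA q a)
| relab_Sl q of q < tm_nq M : relab_spec M (hSl q) lR lS (hRl q)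
| relab_Rl q a of q < tm_nq M & a < tm_ns M :
    relab_spec M (hRl q) (lA a) lR (hA q a).

Lemma relabP M a b c d : 0 < tm_ns M ->
  List.In (Relab a b c d) (tm_rules M) <-> relab_spec M a b c d.
Proof.
move=> Hns; rewrite tm_rulesP; split=> [[q [e [Hq He]]]|].
  rewrite /rules_at In_cat => -[|].
    case E: tm_delta => [[[q' b'] []]|] /=; last by case: ifP => _ /=; case.
      by case=> [[<- <- <- <-]|//]; constructor.
    by case=> [[<- <- <- <-]|//]; constructor.
  by do 4?[case; first by case=> <- <- <- <-; constructor].
case=> [q e q' b' Hq He E|q e q' b' Hq He E|q Hq|q e Hq He|q Hq|q e Hq He].
- by exists q, e; split=> //; rewrite /rules_at E; left.
- by exists q, e; split=> //; rewrite /rules_at E; left.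
(* Transit rules are listed under every symbol; taking symbol 0 is where [0 < tm_ns M] enters. *)
- by exists q, 0; split=> //; rewrite /rules_at In_cat; right; left.
- by exists q, e; split=> //; rewrite /rules_at In_cat; do 2!right; left.
- by exists q, 0; split=> //; rewrite /rules_at In_cat; do 3!right; left.
- by exists q, e; split=> //; rewrite /rules_at In_cat; do 4!right; left.
Qed.

Lemma moveP M a b : List.In (Move a b) (tm_rules M) <->
  exists q e, [/\ q < tm_nq M, e < tm_ns M, tm_delta M q e = None, tm_acc M q
              & (a, b) = (hA q e, lB)].
Proof.
rewrite tm_rulesP; split=> [[q [e [Hq He]]]|[q [e [Hq He E A [-> ->]]]]].
  rewrite /rules_at In_cat => -[|]; last by do 4?case=> //.
  case E: tm_delta => [[[q' b'] []]|] /=; try by case.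
  by case: ifP => //= A [[<- <-]|//]; exists q, e.
by exists q, e; split=> //; rewrite /rules_at E A; left.
Qed.

Lemma tm_rules_ok M : 0 < tm_ns M -> rules_ok (tm_rules M).
Proof.
move=> Hns [a b c d|a b] Hin.
  by move/relabP: Hin => /(_ Hns) [] *; rewrite /is_head /is_idle !kind_lbl.
by move/moveP: Hin => [q [e [_ _ _ _ [-> ->]]]]; rewrite /is_head kind_lbl.
Qed.

(** * Turing configurations as zippers *)

Definition cells (t : seq nat) := flatten [seq [:: lA a; lR; lS] | a <- t].
Definition lcells (t : seq nat) := flatten [seq [:: lS; lR; lA a] | a <- t].

(** The path is finite: [j] and [j'] count the spare blank cells beyond the recorded tape on the
    left and on the right. *)
Definition tm_zipper (c : config) (j j' : nat) : zipper :=
  let: (q, L, a, R) := c in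
  (lcells (L ++ nseq j 0), hA q a, [:: lR, lS & cells (R ++ nseq j' 0)]).

Ltac lbl_simpl := repeat match goal with
  | H : lbl ?k ?q ?a = lbl ?k' ?q' ?a' |- _ =>
     let e1 := fresh in let e2 := fresh in let e3 := fresh in
     case: (lbl_inj H) => e1 e2 e3; clear H; try discriminate e1; subst
  end.

Ltac zstep_inv :=
  let Hr := fresh in let Hz := fresh in
  case=> [[? ?] ?] [? [? [? [/relabP Hr /= Hz]]]];
  move: (Hr ltac:(assumption)) => {}Hr;
  unfold lA, lR, lS, hA, hRr, hSr, hSl, hRl in *;
  inversion Hr; unfold lA, lR, lS, hA, hRr, hSr, hSl, hRl in *; lbl_simpl;
  (case: Hz => -[? ?]);
  repeat match goal with
  | H : _ :: _ = _ :: _ |- _ => injection H; clear H; intros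
  | H : (_, _) = (_, _) |- _ => injection H; clear H; intros
  end; subst; lbl_simpl; try congruence.

Section Simulation.
Variable M : TM.
Hypothesis ns_gt0 : 0 < tm_ns M.
Let R := tm_rules M.

Lemma zmove_head k q a ru rv : k != 5 -> ~ zmove R (ru, lbl k q a, rv).
Proof.
move=> Hk /moveP[q' [e [_ _ _ _ []]]] /lbl_inj[].
by move=> e5; rewrite e5 in Hk.
Qed.

(** In transit exactly one neighbour of the head carries the label its rule asks for: here the S on
    the right, the left neighbour being a symbol node. The next three lemmas follow this pattern. *)
Lemma zrun_Rr q e ru rv b : q < tm_nq M ->
  zrun R (lR :: lA e :: ru, hSr q, rv) b ->
  zrun R (lA e :: ru, hRr q, lS :: rv) b.
Proof.
move=> Hq; apply: zrun_step; first exact: zmove_head.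
  by exists lS, lR, (hSr q); split; [apply/relabP => //; constructor | left].
zstep_inv.
Qed.

Lemma zrun_Sr q a ru rv b : q < tm_nq M -> a < tm_ns M ->
  zrun R (lS :: lR :: ru, hA q a, rv) b ->
  zrun R (lR :: ru, hSr q, lA a :: rv) b.
Proof.
move=> Hq Ha; apply: zrun_step; first exact: zmove_head.
  by exists (lA a), lS, (hA q a); split; [apply/relabP => //; constructor | left].
zstep_inv.
Qed.

Lemma zrun_Sl q e ru rv b : q < tm_nq M ->
  zrun R (ru, hRl q, lS :: lA e :: rv) b ->
  zrun R (lR :: ru, hSl q, lA e :: rv) b.
Proof.
move=> Hq; apply: zrun_step; first exact: zmove_head.
  by exists lR, lS, (hRl q); split; [apply/relabP => //; constructor | right].
zstep_inv.
Qed.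

Lemma zrun_Rl q a ru rv b : q < tm_nq M -> a < tm_ns M ->
  zrun R (ru, hA q a, lR :: lS :: rv) b ->
  zrun R (lA a :: ru, hRl q, lS :: rv) b.
Proof.
move=> Hq Ha; apply: zrun_step; first exact: zmove_head.
  by exists (lA a), lR, (hA q a); split; [apply/relabP => //; constructor | right].
zstep_inv.
Qed.

Lemma zmove_hA q a ru rv : zmove R (ru, hA q a, rv) ->
  tm_delta M q a = None /\ tm_acc M q.
Proof. by move=> /moveP[q' [e [_ _ E A []]]] /lbl_inj[_ -> ->]. Qed.

(** The condition on [ohead ru] excludes the same rule applied to the left; in a tape the left
    neighbour, if any, is an S. *)
Lemma zrun_hA_right q a q' e ru rv b : q < tm_nq M -> a < tm_ns M ->
  tm_delta M q a = Some (q', e, true) ->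
  ohead ru != Some lR ->
  zrun R (lA e :: ru, hRr q', rv) b -> zrun R (ru, hA q a, lR :: rv) b.
Proof.
move=> Hq Ha E Hru; apply: zrun_step; first by case/zmove_hA; rewrite E.
  by exists lR, (lA e), (hRr q'); split; [apply/relabP => //; constructor | left].
by zstep_inv; rewrite eqxx in Hru.
Qed.

Lemma zrun_hA_left q a q' e ru rv b : q < tm_nq M -> a < tm_ns M ->
  tm_delta M q a = Some (q', e, false) ->
  zrun R (ru, hSl q', lA e :: lR :: rv) b ->
  zrun R (lS :: ru, hA q a, lR :: rv) b.
Proof.
move=> Hq Ha E; apply: zrun_step; first by case/zmove_hA; rewrite E.
  by exists lS, (lA e), (hSl q'); split; [apply/relabP => //; constructor | right].
zstep_inv.
Qed.

Lemma zrun_halt q a ru rv : q < tm_nq M -> a < tm_ns M ->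
  tm_delta M q a = None -> zrun R (ru, hA q a, rv) (tm_acc M q).
Proof.
move=> Hq Ha E.
have Hn z' : ~ zstep R (ru, hA q a, rv) z'.
  by move: z'; zstep_inv.
case A: (tm_acc M q); [apply: zrun_acc | apply: zrun_rej] => //.
  by apply/moveP; exists q, a.
by case/zmove_hA; rewrite A.
Qed.

Lemma ohead_lcells t : ohead (lcells t) != Some lR.
Proof.
case: t => [|a t] //=; apply/eqP=> -[H].
by have := congr1 kind H; rewrite !kind_lbl.
Qed.

(* The number of blank cells on either side only shrinks when the visited
   part of the tape grows, so the space bound [m] keeps the head on the path. *)
Lemma tm_zrun n c cf m j j' : tm_wf M ->
  tm_exec M n c = Some cf -> tm_step M cf = None ->
  (forall i c', i <= n -> tm_exec M i c = Some c' -> cfg_space c' <= m) ->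
  cfg_state c < tm_nq M ->
  all (fun a => a < tm_ns M) (c.1.1.2 ++ c.1.2 :: c.2) ->
  m <= j + cfg_space c -> m <= j' + cfg_space c ->
  zrun R (tm_zipper c j j') (tm_acc M (cfg_state cf)).
Proof.
move=> [_ _ Hd]; elim: n c j j' => [|n IH] [[[q L] a] Rt] j j' /=.
  move=> -[<-] /=; case E: tm_delta => [[[q' b] []]|] //= _ _ Hq.
  by rewrite all_cat /= => /and3P[_ Ha _] _ _; apply: zrun_halt.
case E: tm_delta => [[[q' b] dir]|] //= Hex Hst Hsp Hq.
rewrite /cfg_state /= in Hq *.
rewrite all_cat /= => /and3P[HL Ha HR] Hj Hj'.
have [Hq' Hb] := Hd _ _ Hq Ha _ _ _ E.
have {}Hsp i c' c1 : (if dir then Some (q', b :: L, head 0 Rt, behead Rt)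
                else Some (q', behead L, head 0 L, b :: Rt)) = Some c1 ->
    i <= n -> tm_exec M i c1 = Some c' -> cfg_space c' <= m.
  by move=> E1 Hi Hc; apply: (Hsp i.+1) => //=; rewrite E E1.
case: dir E Hex Hsp => E Hex /(_ _ _ _ erefl) Hsp.
  have {}IH k := IH _ j k Hex Hst Hsp.
  have sp : size (b :: L) + size (behead Rt) + 1 <= m := Hsp 0 _ isT erefl.
  apply: (zrun_hA_right Hq Ha E); first exact: ohead_lcells.
  apply: zrun_Rr => //.
  case: Rt HR Hj Hj' Hex Hsp sp IH => [|a' Rt] /= HR Hj Hj' Hex Hsp sp IH.
    rewrite /cfg_space /= in Hj Hj' sp.
    (* With [j' = 0], [Hj'] would give [m <= size L + 1], whereas by [sp] the successor takes
       [size L + 2] cells. *)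
    case: j' Hj' => [|j'] Hj'; first by lia.
    apply: zrun_Sr => //; apply: (IH j') => //=; rewrite /cfg_space /=; try lia.
    by rewrite all_cat /= Hb HL ns_gt0.
  rewrite /cfg_space /= in Hj Hj' sp.
  case/andP: HR => Ha' HR.
  apply: zrun_Sr => //; apply: (IH j') => //=; rewrite /cfg_space /=; try lia.
  by rewrite all_cat /= Hb HL Ha'.
have {}IH k := IH _ k j' Hex Hst Hsp.
have sp : size (behead L) + size (b :: Rt) + 1 <= m := Hsp 0 _ isT erefl.
case: L HL Hj Hj' Hex Hsp sp IH => [|a' L] /= HL Hj Hj' Hex Hsp sp IH.
  rewrite /cfg_space /= in Hj Hj' sp.
  case: j Hj => [|j] Hj; first by lia.
  apply: (zrun_hA_left Hq Ha E); apply: zrun_Sl => //; apply: zrun_Rl => //.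
  apply: (IH j) => //=; rewrite /cfg_space /=; try lia.
rewrite /cfg_space /= in Hj Hj' sp.
case/andP: HL => Ha' HL.
apply: (zrun_hA_left Hq Ha E); apply: zrun_Sl => //; apply: zrun_Rl => //.
apply: (IH j) => //=; rewrite /cfg_space /=; try lia.
by rewrite all_cat /= Hb HL Ha'.
Qed.

(** The head starts in transit on the S node of an extra blank cell left of the input, so its label
    does not depend on the input. *)
Definition start_zipper (x : seq bool) (m : nat) : zipper :=
  (lR :: lA 0 :: lcells (nseq m 0), hSr 0, cells (map bit_sym x ++ nseq m 0)).

Lemma start_zipper_run n x cf m : tm_wf M ->
  tm_exec M n (tm_init x) = Some cf -> tm_step M cf = None ->
  (forall i c', i <= n -> tm_exec M i (tm_init x) = Some c' -> cfg_space c' <= m) ->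
  zrun R (start_zipper x m) (tm_acc M (cfg_state cf)).
Proof.
move=> Hwf Hex Hst Hsp; have [Hq Hns _] := Hwf.
have bs : all (fun a => a < tm_ns M) (map bit_sym x).
  by apply/allP=> a /mapP[[] _ ->]; rewrite /bit_sym; lia.
have sp : cfg_space (tm_init x) <= m := Hsp 0 _ isT erefl.
have H k := @tm_zrun n _ cf m m.+1 k Hwf Hex Hst Hsp.
rewrite /start_zipper; case: x Hex Hsp bs sp H => [|b x] /= Hex Hsp bs sp H.
  (* On empty input the first scanned blank comes from the right block, nonempty because the initial
     configuration occupies one cell. *)
  case: m sp Hsp H => [|m] sp Hsp H; first by rewrite /cfg_space in sp.
  apply: zrun_Sr => //; apply: (H m) => //=; rewrite /cfg_space /=; try lia.
case/andP: bs => Hb bs.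
apply: zrun_Sr => //; apply: (H m) => //=; rewrite /cfg_space /=; try lia.
Qed.

Lemma start_zipper_ok x m : zipper_ok (start_zipper x m).
Proof.
have iA a : is_idle (lA a) by rewrite /is_idle kind_lbl.
have iR : is_idle lR by rewrite /is_idle kind_lbl.
have iS : is_idle lS by rewrite /is_idle kind_lbl.
have idl t : all is_idle (lcells t) && all is_idle (cells t).
  by elim: t => //= a t IH; rewrite iA iR iS.
rewrite /zipper_ok /= iA iR /is_head kind_lbl /=.
by rewrite (andP (idl (nseq m 0))).1 (andP (idl _)).2.
Qed.

End Simulation.

(** * Queue machines *)

Local Arguments iota : simpl never.

(** * Turing machines with states from a finite list *)

Section Compile.
Variables (Q : eqType) (q0 : Q) (qs : seq Q) (ns : nat).
Variable delta : Q -> nat -> option (Q * nat * bool).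

(** The range test makes the machine well formed for any [delta]; membership in [qs] is then checked
    only for transitions actually executed. *)
Definition compile_tm : TM := MkTM (size qs) ns
  (fun i a => if delta (nth q0 qs i) a is Some (q, b, dir) then
     if (q \in qs) && (b < ns) then Some (index q qs, b, dir) else None
   else None) (fun=> false).

Lemma compile_tm_wf : 0 < size qs -> 3 <= ns -> tm_wf compile_tm.
Proof.
move=> Hq Hn; split=> // q a _ _ q' b d /=.
case: delta => [[[q1 b1] d1]|] //; case: ifP => // /andP[Hq1 Hb1] [<- <- _].
by rewrite index_mem.
Qed.

(* [R] starts with the scanned symbol. *)
Definition conf (q : Q) (L R : seq nat) : config :=
  (index q qs, L, head 0 R, behead R).

Lemma compile_right q L R q' b : q \in qs -> q' \in qs -> b < ns ->
  delta q (head 0 R) = Some (q', b, true) ->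
  tm_step compile_tm (conf q L R) = Some (conf q' (b :: L) (behead R)).
Proof. by move=> Hq Hq' Hb E; rewrite /= nth_index // E Hq' Hb. Qed.

Lemma compile_left q L R q' b : q \in qs -> q' \in qs -> b < ns ->
  delta q (head 0 R) = Some (q', b, false) ->
  tm_step compile_tm (conf q L R) =
  Some (conf q' (behead L) (head 0 L :: b :: behead R)).
Proof. by move=> Hq Hq' Hb E; rewrite /= nth_index // E Hq' Hb. Qed.

Lemma compile_halt q L R : q \in qs -> delta q (head 0 R) = None ->
  tm_step compile_tm (conf q L R) = None.
Proof. by move=> Hq E; rewrite /= nth_index // E. Qed.

End Compile.

Lemma tm_exec_add M n1 n2 c c1 c2 : tm_exec M n1 c = Some c1 ->
  tm_exec M n2 c1 = Some c2 -> tm_exec M (n1 + n2) c = Some c2.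
Proof.
elim: n1 c => [|n1 IH] c /=; first by move=> [->].
by case: tm_step => // c' /IH.
Qed.

Lemma tm_exec1 M c c1 : tm_step M c = Some c1 -> tm_exec M 1 c = Some c1.
Proof. by move=> /= ->. Qed.

(** * Iterated substitutions on words *)

Definition hom (h : nat -> seq nat) (w : seq nat) : seq nat := flatten (map h w).

Lemma hom_cat h u v : hom h (u ++ v) = hom h u ++ hom h v.
Proof. by rewrite /hom map_cat flatten_cat. Qed.

Lemma hom_cons h a v : hom h (a :: v) = h a ++ hom h v.
Proof. by []. Qed.

Lemma hom1 h a : hom h [:: a] = h a.
Proof. by rewrite /hom /= cats0. Qed.

Lemma iter_hom_cat h j u v :
  iter j (hom h) (u ++ v) = iter j (hom h) u ++ iter j (hom h) v.
Proof. by elim: j => //= j ->; rewrite hom_cat. Qed.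

Lemma iter_hom_nil h j : iter j (hom h) [::] = [::].
Proof. by elim: j => //= j ->. Qed.

Lemma iter_homE h j w : iter j (hom h) w = hom (fun a => iter j (hom h) [:: a]) w.
Proof.
elim: w => [|a w IH]; first by rewrite iter_hom_nil.
by rewrite -cat1s iter_hom_cat IH hom_cat hom1.
Qed.

Lemma eq_in_hom h h' w : {in w, h =1 h'} -> hom h w = hom h' w.
Proof. by move=> H; rewrite /hom; congr flatten; apply/eq_in_map. Qed.

(* An instruction sweeps the word repeatedly: each sweep replaces the first symbol
   [c] of the class [oC] by [og c] and every other symbol [a] by [oh a], until a
   sweep meets no symbol of the class.  Since [oh] preserves class symbols, [opres]
   is the closed form of the result. *)
Record op := Op { oC : pred nat; og : nat -> seq nat; oh : nat -> seq nat }.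

Definition op_id : op := Op pred0 (fun a => [:: a]) (fun a => [:: a]).

(** The successor counts the final sweep, which meets no class symbol but still applies [oh]. *)
Definition opres (o : op) (w : seq nat) : seq nat :=
  hom (fun a => if oC o a then og o a
                else iter (count (oC o) w).+1 (hom (oh o)) [:: a]) w.

Definition letter (dl a : nat) : bool := 0 < a < dl.

(** The size conditions keep words from shrinking. The last four say that class symbols wait
    unchanged, that none is created, and that the output of [og] survives later sweeps. *)
Record op_ok (dl : nat) (o : op) : Prop := OpOk {
  oh_letter : forall a, letter dl a -> all (letter dl) (oh o a);
  og_letter : forall a, letter dl a -> oC o a -> all (letter dl) (og o a);
  oh_size : forall a, letter dl a -> 0 < size (oh o a);
  og_size : forall a, letter dl a -> oC o a -> 0 < size (og o a);
  oh_C : forall a, letter dl a -> oC o a -> oh o a = [:: a];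
  oh_nC : forall a, letter dl a -> ~~ oC o a -> ~~ has (oC o) (oh o a);
  og_nC : forall a, letter dl a -> oC o a -> ~~ has (oC o) (og o a);
  og_fix : forall a, letter dl a -> oC o a -> hom (oh o) (og o a) = og o a }.

Fixpoint pass (o : op) (m : bool) (w : seq nat) : bool * seq nat :=
  match w with
  | [::] => (m, [::])
  | a :: w' =>
    if ~~ m && oC o a then
      let r := pass o true w' in (r.1, og o a ++ r.2)
    else let r := pass o m w' in (r.1, oh o a ++ r.2)
  end.

Lemma pass_true o w : pass o true w = (true, hom (oh o) w).
Proof. by elim: w => //= a w ->. Qed.

Lemma pass_nohas o w : ~~ has (oC o) w -> pass o false w = (false, hom (oh o) w).
Proof. by elim: w => //= a w IH; rewrite negb_or => /andP[/negbTE-> /IH->]. Qed.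

Lemma pass_has o w : has (oC o) w -> (pass o false w).1.
Proof.
elim: w => //= a w IH; case: ifP => _ /=; last by [].
by rewrite pass_true.
Qed.

Section PassOk.
Variables (dl : nat) (o : op).
Hypothesis Ho : op_ok dl o.

Lemma pass_letter m w : all (letter dl) w -> all (letter dl) (pass o m w).2.
Proof.
elim: w m => //= a w IH m /andP[Ha Hw].
by case: ifP => [/andP[_ HC]|_] /=; rewrite all_cat IH // andbT;
  [apply: (og_letter Ho) | apply: (oh_letter Ho)].
Qed.

Lemma pass_size m w : all (letter dl) w -> size w <= size (pass o m w).2.
Proof.
elim: w m => //= a w IH m /andP[Ha Hw].
by case: ifP => [/andP[_ HC]|_] /=; rewrite size_cat -add1n leq_add ?IH //;
  [apply: (og_size Ho) | apply: (oh_size Ho)].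
Qed.

Lemma count_oh a : letter dl a -> count (oC o) (oh o a) = oC o a.
Proof.
move=> Ha; case HC: (oC o a); first by rewrite (oh_C Ho) //= HC.
by apply/eqP; rewrite eqn0Ngt -has_count (oh_nC Ho) ?HC.
Qed.

Lemma count_hom w : all (letter dl) w ->
  count (oC o) (hom (oh o) w) = count (oC o) w.
Proof.
elim: w => //= a w IH /andP[Ha Hw].
by rewrite hom_cons count_cat IH // count_oh.
Qed.

Lemma count_pass w : all (letter dl) w -> has (oC o) w ->
  (count (oC o) (pass o false w).2).+1 = count (oC o) w.
Proof.
elim: w => //= a w IH /andP[Ha Hw]; case: ifP => HC /=.
  rewrite pass_true count_cat /= count_hom //.
  have := og_nC Ho Ha HC; rewrite has_count -eqn0Ngt => /eqP-> _.
  by rewrite add0n add1n.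
by move=> /IH <- //; rewrite count_cat count_oh // HC.
Qed.

Let phi j a := if oC o a then og o a else iter j (hom (oh o)) [:: a].

Lemma phi_nohas j w : ~~ has (oC o) w -> hom (phi j) w = iter j (hom (oh o)) w.
Proof.
move=> /hasPn H; rewrite iter_homE; apply: eq_in_hom => a /H.
by rewrite /phi => /negbTE->.
Qed.

Lemma phi_oh j a : letter dl a -> hom (phi j) (oh o a) = phi j.+1 a.
Proof.
move=> Ha; rewrite {2}/phi; case HC: (oC o a).
  by rewrite (oh_C Ho) // hom1 /phi HC.
by rewrite phi_nohas ?(oh_nC Ho) ?HC // iterSr hom1.
Qed.

Lemma phi_hom j w : all (letter dl) w -> hom (phi j) (hom (oh o) w) = hom (phi j.+1) w.
Proof.
elim: w => //= a w IH /andP[Ha Hw].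
by rewrite !hom_cons hom_cat IH // phi_oh.
Qed.

(** A sweep accounts for one unit of [j]: replaced symbols are protected by [og_fix], waiting ones
    by [oh_C], and the rest advance by one [oh]. In [opres_pass] this offsets the drop of the
    count. *)
Lemma phi_pass j w : all (letter dl) w ->
  hom (phi j) (pass o false w).2 = hom (phi j.+1) w.
Proof.
elim: w => //= a w IH /andP[Ha Hw]; case: ifP => HC /=.
  rewrite pass_true hom_cat phi_hom // hom_cons; congr (_ ++ _).
  rewrite phi_nohas ?(og_nC Ho) // {1}/phi HC.
  by elim: j {IH} => //= j ->; rewrite (og_fix Ho).
by rewrite hom_cat IH // phi_oh.
Qed.

Lemma opres_pass w : all (letter dl) w -> has (oC o) w ->
  opres o (pass o false w).2 = opres o w.
Proof.
move=> Hw HC; rewrite {2}/opres -count_pass //.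
by rewrite -(phi_pass _ Hw).
Qed.

Lemma opres_nohas w : ~~ has (oC o) w -> opres o w = hom (oh o) w.
Proof.
move=> HC; rewrite /opres.
have -> : count (oC o) w = 0 by apply/eqP; rewrite eqn0Ngt -has_count.
by rewrite (phi_nohas 1).
Qed.

End PassOk.

(** [X], [p], [H], [F] stand for the lengths of the input, of [pre], of the word left by instruction
    0 without [pre], and of the output; [N] counts instructions. The summands are initialization,
    first sweep, end marker, and remaining instructions. *)
Lemma time_bound F X H p N : X.+1 <= H -> p + H <= F ->
  2 * (X + p.+2) + 4 + (X.+1 * (2 * (X.+1 + p.+1 + H) + 3) + (2 * (p + H) + 5) +
    (N - 1) * (F.+1 * (F.+1 * (4 * F + 5)))) <= (5 * N + 18) * F.+1 ^ 3.
Proof.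
move=> S1 J2; set G := F.+1.
have B1 : 2 * (X + p.+2) + 4 <= 8 * G by rewrite /G; lia.
have B2 : X.+1 * (2 * (X.+1 + p.+1 + H) + 3) <= G * (4 * G + 1).
  by rewrite /G; apply: leq_mul; lia.
have B3 : 2 * (p + H) + 5 <= 5 * G by rewrite /G; lia.
have B4 : (N - 1) * (G * (G * (4 * F + 5))) <= N * (G * (G * (5 * G))).
  by apply: leq_mul; [lia | do 2!apply: leq_mul => //; rewrite /G; lia].
have B5 : G * 1 <= G * G by rewrite leq_mul2l orbT.
have B6 : G * G <= G * (G * G) by rewrite leq_mul2l leq_pmulr ?orbT.
move: B1 B2 B3 B4 B5 B6; rewrite !expnS expn0 muln1; clear; lia.
Qed.

(** * The queue machine and its running time *)

Section QueueMachine.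
Variables (dl : nat) (ops : seq op) (pre : seq nat) (ys : nat).
Hypothesis dl_ge : 3 <= dl.
Hypothesis ys_letter : letter dl ys.
Hypothesis pre_letter : all (letter dl) pre.
Hypothesis ops_ok : forall i, i < size ops -> op_ok dl (nth op_id ops i).

(* The queue holds a word followed by the end marker [dl].  In control state
   [(i, m)] instruction [i] is being swept; [m] records whether the current sweep
   has already met a symbol of the class. *)
Definition qtrans (p : nat * bool) (a : nat) : (nat * bool) * seq nat :=
  let o := nth op_id ops p.1 in
  if a == dl then ((if p.2 then p.1 else p.1.+1, false), [:: dl])
  else if ~~ p.2 && oC o a then ((p.1, true), og o a) else (p, oh o a).

Notation qstate := (nat * (nat * bool) * seq nat)%type.
Definition sStart : qstate := (0, (0, false), [::]).
Definition sLeft : qstate := (1, (0, false), [::]).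
Definition sRead p : qstate := (2, p, [::]).
Definition sFwd p u : qstate := (3, p, u).
Definition sBack p : qstate := (4, p, [::]).

(* The input has no end marker yet; the first sweep starts from the queue
   [x ys dl pre], whose last part [pre] it leaves alone. *)
Definition start_word := [:: ys, dl & pre].

(** Popping writes 0 at the front; the machine walks to the first blank, appends, and returns to
    that 0. Queue symbols are positive, so 0 serves both as blank and as left boundary. States 0 and
    1 set up this boundary before the input. *)
Definition qdelta (q : qstate) (a : nat) : option (qstate * nat * bool) :=
  let: (t, p, u) := q in
  match t with
  | 0 => Some (sLeft, a, false)
  | 1 => Some (sFwd (0, false) start_word, 0, true)
  | 2 => if p.1 < size ops then
           Some (sFwd (qtrans p a).1 (qtrans p a).2, 0, true)
         else None
  | 3 => if a == 0 then
           if u is c :: u' then Some (sFwd p u', c, true)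
           else Some (sBack p, 0, false)
         else Some (sFwd p u, a, true)
  | _ => if a == 0 then Some (sRead p, 0, true) else Some (sBack p, a, false)
  end.

Definition controls := [seq (i, m) | i <- iota 0 (size ops).+1, m <- [:: false; true]].
Definition words :=
  start_word :: [seq (qtrans p a).2 | p <- controls, a <- iota 0 dl.+1].
Definition suffixes :=
  flatten [seq [seq drop k u | k <- iota 0 (size u).+1] | u <- words].
Definition qstates : seq qstate :=
  [:: sStart; sLeft] ++ map sRead controls ++ map sBack controls ++
  [seq sFwd p u | p <- controls, u <- suffixes].

Definition qtm := compile_tm sStart qstates dl.+1 qdelta.
Notation cnf := (conf qstates).

Lemma mem_controls i m : ((i, m) \in controls) = (i <= size ops).
Proof.
apply/allpairsP/idP => [[[i' m'] [/= Hi _ [-> _]]]|Hi].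
  by rewrite mem_iota in Hi.
by exists (i, m); rewrite /= mem_iota; split=> //; case: m.
Qed.

Lemma mem_suffixes u : u \in words -> u \in suffixes.
Proof.
move=> Hu; apply/flatten_mapP; exists u => //.
by apply/mapP; exists 0; rewrite ?drop0 // mem_iota.
Qed.

Lemma suffixes_tail c u : c :: u \in suffixes -> u \in suffixes.
Proof.
move=> /flatten_mapP[w Hw /mapP[k]]; rewrite mem_iota => Hk E.
apply/flatten_mapP; exists w => //; apply/mapP; exists k.+1.
  rewrite mem_iota /=; have := congr1 size E; rewrite size_drop /=; lia.
by rewrite -add1n -drop_drop -E /= drop0.
Qed.

Lemma mem_sStart : sStart \in qstates. Proof. by rewrite mem_head. Qed.
Lemma mem_sLeft : sLeft \in qstates. Proof. by []. Qed.
Lemma mem_sRead p : p \in controls -> sRead p \in qstates.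
Proof. by move=> Hp; rewrite !mem_cat (map_f sRead Hp) orbT. Qed.
Lemma mem_sBack p : p \in controls -> sBack p \in qstates.
Proof. by move=> Hp; rewrite !mem_cat (map_f sBack Hp) !orbT. Qed.
Lemma mem_sFwd p u : p \in controls -> u \in suffixes -> sFwd p u \in qstates.
Proof.
move=> Hp Hu.
have H : sFwd p u \in [seq sFwd p u | p <- controls, u <- suffixes].
  by apply/allpairsP; exists (p, u).
by rewrite /qstates mem_cat; apply/orP; right; rewrite mem_cat; apply/orP; right;
  rewrite mem_cat; apply/orP; right.
Qed.

Definition qsym a := 0 < a <= dl.

Lemma fwd_walk p u w L R : sFwd p u \in qstates -> all qsym w ->
  tm_exec qtm (size w) (cnf (sFwd p u) L (w ++ R)) =
  Some (cnf (sFwd p u) (rev w ++ L) R).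
Proof.
move=> Hs; elim: w L => [|a w IH] L //= /andP[/andP[a0 Ha] Hw].
have E : qdelta (sFwd p u) a = Some (sFwd p u, a, true) by rewrite /= eqn0Ngt a0.
have := @compile_right _ sStart qstates dl.+1 qdelta _ L (a :: w ++ R) _ a Hs Hs Ha E.
by rewrite /= -/qtm => ->; rewrite (IH (a :: L) Hw) rev_cons cat_rcons.
Qed.

Lemma fwd_write p u L r : p \in controls -> u \in suffixes -> all qsym u ->
  tm_exec qtm (size u) (cnf (sFwd p u) L (nseq r 0)) =
  Some (cnf (sFwd p [::]) (rev u ++ L) (nseq (r - size u) 0)).
Proof.
move=> Hp; elim: u L r => [|c u IH] L r Hu; first by rewrite subn0.
move=> /andP[/andP[c0 Hc] Hw].
have Hu' := suffixes_tail Hu.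
have E : qdelta (sFwd p (c :: u)) (head 0 (nseq r 0)) = Some (sFwd p u, c, true).
  by case: r.
have := @compile_right _ sStart qstates dl.+1 qdelta _ L (nseq r 0) _ c
   (mem_sFwd Hp Hu) (mem_sFwd Hp Hu') Hc E.
move=> /tm_exec1 H1; apply: (@tm_exec_add _ 1 (size u)) H1 _.
have -> : behead (nseq r 0) = nseq r.-1 0 by case: r {E}.
rewrite (IH (c :: L)) // rev_cons cat_rcons; congr (Some (cnf _ _ (nseq _ _))).
by case: r {E}.
Qed.

(** [w] is the stretch to cross, nearest symbol first; [head] and [behead] cover the empty [w]
    too. *)
Lemma back_walk p w L R : p \in controls -> all qsym w ->
  tm_exec qtm (size w)
    (cnf (sBack p) (behead (w ++ 0 :: L)) (head 0 (w ++ 0 :: L) :: R)) =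
  Some (cnf (sBack p) L (0 :: rev w ++ R)).
Proof.
move=> /mem_sBack Hs; elim: w R => [|a w IH] R //= /andP[/andP[a0 Ha] Hw].
have E : qdelta (sBack p) a = Some (sBack p, a, false) by rewrite /= eqn0Ngt a0.
have := @compile_left _ sStart qstates dl.+1 qdelta _
  (w ++ 0 :: L) (a :: R) _ a Hs Hs Ha E.
by rewrite /= -/qtm => ->; rewrite (IH (a :: R) Hw) rev_cons cat_rcons.
Qed.

Lemma append_exec p u w L r : p \in controls -> u \in suffixes ->
  all qsym w -> all qsym u ->
  exists r', tm_exec qtm (2 * (size w + size u) + 2)
      (cnf (sFwd p u) (0 :: L) (w ++ nseq r 0)) =
    Some (cnf (sRead p) (0 :: L) (w ++ u ++ nseq r' 0)).
Proof.
(* Turning back writes an explicit 0 even when no explicit blank is left, so at least one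
   remains. *)
move=> Hp Hu Hw Hqu; exists (r - size u).-1.+1.
have Hnil : [::] \in suffixes.
  by elim: u Hu {Hqu} => // c u IH /suffixes_tail.
have H1 := fwd_walk (0 :: L) (nseq r 0) (mem_sFwd Hp Hu) Hw.
have H2 := fwd_write (rev w ++ 0 :: L) r Hp Hu Hqu.
set r1 := r - size u in H2 *; set L1 := rev u ++ _ in H2.
have E : qdelta (sFwd p [::]) (head 0 (nseq r1 0)) = Some (sBack p, 0, false).
  by case: (r1).
have := @compile_left _ sStart qstates dl.+1 qdelta _ L1 (nseq r1 0) _ 0
   (mem_sFwd Hp Hnil) (mem_sBack Hp) (ltn0Sn _) E.
move=> /tm_exec1 H3.
have eL : L1 = rev (w ++ u) ++ 0 :: L by rewrite /L1 rev_cat catA.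
have Hwu : all qsym (rev (w ++ u)) by rewrite all_rev all_cat Hw Hqu.
have H4 := back_walk L (0 :: behead (nseq r1 0)) Hp Hwu.
rewrite -eL revK in H4.
have E5 : qdelta (sBack p) (head 0 (0 :: (w ++ u) ++ 0 :: behead (nseq r1 0))) =
   Some (sRead p, 0, true) by [].
have := @compile_right _ sStart qstates dl.+1 qdelta _ L _ _ 0
   (mem_sBack Hp) (mem_sRead Hp) (ltn0Sn _) E5.
move=> /tm_exec1 H5.
have := tm_exec_add (tm_exec_add (tm_exec_add (tm_exec_add H1 H2) H3) H4) H5.
rewrite size_rev size_cat /= => H.
have -> : 2 * (size w + size u) + 2 =
  size w + size u + 1 + (size w + size u) + 1 by lia.
rewrite H -catA; congr (Some (cnf _ _ (_ ++ (_ ++ _)))).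
by case: (r1).
Qed.

(** Erased cells pile up on the left and explicit blanks vary on the right; abstracting from both
    leaves a relation on queues that composes. *)
Definition qreach (B : nat) p w p' w' := forall L r, exists L' r' n,
  n <= B /\ tm_exec qtm n (cnf (sRead p) L (w ++ nseq r 0)) =
            Some (cnf (sRead p') L' (w' ++ nseq r' 0)).

Lemma qreach_trans B1 B2 p1 w1 p2 w2 p3 w3 : qreach B1 p1 w1 p2 w2 ->
  qreach B2 p2 w2 p3 w3 -> qreach (B1 + B2) p1 w1 p3 w3.
Proof.
move=> H1 H2 L r; have [L1 [r1 [n1 [Hn1 E1]]]] := H1 L r.
have [L2 [r2 [n2 [Hn2 E2]]]] := H2 L1 r1.
by exists L2, r2, (n1 + n2); rewrite leq_add // (tm_exec_add E1 E2).
Qed.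

Lemma qreach_mono B1 B2 p1 w1 p2 w2 : B1 <= B2 -> qreach B1 p1 w1 p2 w2 ->
  qreach B2 p1 w1 p2 w2.
Proof.
move=> HB H L r; have [L1 [r1 [n1 [Hn1 E1]]]] := H L r.
by exists L1, r1, n1; rewrite (leq_trans Hn1).
Qed.

Lemma qreach0 p w : qreach 0 p w p w.
Proof. by move=> L r; exists L, r, 0. Qed.

Lemma letter_qsym w : all (letter dl) w -> all qsym w.
Proof. by apply: sub_all => a /andP[? /ltnW ?]; apply/andP. Qed.

Lemma qreach_step i m a w : i < size ops -> qsym a -> all qsym w ->
  let t := qtrans (i, m) a in
  qreach (2 * (size w + size t.2) + 3) (i, m) (a :: w) t.1 (w ++ t.2).
Proof.
move=> Hi Ha Hw t L r.
have Ho := ops_ok Hi.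
have Hc : (i, m) \in controls by rewrite mem_controls ltnW.
have Ht1 : t.1 \in controls.
  by rewrite /t /qtrans /=; case: ifP => _; [case: m {t Hc} | case: ifP => _];
    rewrite /= ?mem_controls //; lia.
have Ht2 : t.2 \in suffixes.
  apply: mem_suffixes; rewrite inE; apply/orP; right.
  apply/allpairsP; exists ((i, m), a); split=> //=.
  by rewrite mem_iota; move: Ha; rewrite /qsym; lia.
have Hq2 : all qsym t.2.
  rewrite /t /qtrans /=; case: eqP => [_|/eqP ne] /=.
    by rewrite /qsym leqnn; lia.
  have Hl : letter dl a by move: Ha ne; rewrite /qsym /letter; lia.
  case: ifP => [/andP[_ HC]|_]; apply: letter_qsym.
    exact: (og_letter Ho).
  exact: (oh_letter Ho).
have E : qdelta (sRead (i, m)) a = Some (sFwd t.1 t.2, 0, true) by rewrite /= Hi.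
have := @compile_right _ sStart qstates dl.+1 qdelta _ L (a :: w ++ nseq r 0) _ 0
   (mem_sRead Hc) (mem_sFwd Ht1 Ht2) (ltn0Sn _) E.
move=> /tm_exec1 H1.
have [r' H2] := append_exec L r Ht1 Ht2 Hw Hq2.
exists (0 :: L), r', (1 + (2 * (size w + size t.2) + 2)); split; first lia.
by rewrite (tm_exec_add H1 H2) catA.
Qed.

(** [rest] holds the end marker and whatever is already appended behind the unswept word; it grows
    along the induction. *)
Lemma qreach_pass i m w rest : i < size ops -> all (letter dl) w -> all qsym rest ->
  let t := pass (nth op_id ops i) m w in
  qreach (size w * (2 * (size w + size rest + size t.2) + 3))
    (i, m) (w ++ rest) (i, t.1) (rest ++ t.2).
Proof.
move=> Hi; elim: w m rest => [|a w IH] m rest /=.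
  by rewrite cats0 => _ _; apply: qreach0.
move=> /andP[Ha Hw] Hr.
have /andP[a0 Ha'] := Ha.
have Hqa : qsym a by rewrite /qsym a0 ltnW.
have Hwr : all qsym (w ++ rest) by rewrite all_cat letter_qsym.
have H1 := qreach_step m Hi Hqa Hwr.
have Ho := ops_ok Hi.
have ne : (a == dl) = false by lia.
set o := nth _ _ _ in H1 IH Ho *.
have K m' u : all (letter dl) u ->
    qreach (2 * (size (w ++ rest) + size u) + 3)
      (i, m) (a :: w ++ rest) (i, m') ((w ++ rest) ++ u) ->
    let t := pass o m' w in
    qreach ((size w).+1 * (2 * ((size w).+1 + size rest + size (u ++ t.2)) + 3))
      (i, m) (a :: w ++ rest) (i, t.1) (rest ++ u ++ t.2).
  move=> Hu K1 t; rewrite -catA in K1.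
  have Hru : all qsym (rest ++ u) by rewrite all_cat Hr letter_qsym.
  have := qreach_trans K1 (IH m' (rest ++ u) Hw Hru).
  rewrite -/t -!catA; apply: qreach_mono; rewrite !size_cat; nia.
move: H1 K; rewrite /= /qtrans /= ne -/o.
case: ifP => [/andP[_ HC]|_] /= H1 K; apply: K => //.
  exact: (og_letter Ho).
exact: (oh_letter Ho).
Qed.

Lemma qreach_dl i m w : i < size ops -> all (letter dl) w ->
  qreach (2 * size w + 5) (i, m) (dl :: w) (if m then i else i.+1, false) (w ++ [:: dl]).
Proof.
move=> Hi Hw; have Hd : qsym dl by rewrite /qsym leqnn; lia.
have := qreach_step m Hi Hd (letter_qsym Hw).
by rewrite /= /qtrans /= eqxx /=; apply: qreach_mono; lia.
Qed.

Lemma qreach_full i w : i < size ops -> all (letter dl) w ->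
  let o := nth op_id ops i in let t := pass o false w in
  qreach ((size t.2).+1 * (4 * size t.2 + 5)) (i, false) (w ++ [:: dl])
    (if t.1 then i else i.+1, false) (t.2 ++ [:: dl]).
Proof.
move=> Hi Hw o t.
have Hd : all qsym [:: dl] by rewrite /= /qsym leqnn; lia.
have H1 := qreach_pass false Hi Hw Hd.
have Ht : all (letter dl) t.2 by apply: pass_letter => //; apply: ops_ok.
have H2 := qreach_dl t.1 Hi Ht.
have := qreach_trans H1 H2; apply: qreach_mono; rewrite -/o -/t.
have := pass_size (ops_ok Hi) false Hw; rewrite -/o -/t /=; nia.
Qed.

(** Words never shrink, so each of the [count + 1] sweeps costs at most a quadratic in the final
    length [F]. *)
Lemma qreach_op i w : i < size ops -> all (letter dl) w ->
  let o := nth op_id ops i in let F := size (opres o w) in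
  [/\ all (letter dl) (opres o w), size w <= F &
   qreach ((count (oC o) w).+1 * (F.+1 * (4 * F + 5)))
     (i, false) (w ++ [:: dl]) (i.+1, false) (opres o w ++ [:: dl])].
Proof.
move=> Hi Hw o; have Ho : op_ok dl o := ops_ok Hi.
move: {2}(count _ _) (leqnn (count (oC o) w)) => n.
elim: n w Hw => [|n IH] w Hw Hn F; case HC : (has (oC o) w).
- by move: HC; rewrite has_count; lia.
- move/negbT: HC => HC; have E := opres_nohas HC.
  have := qreach_full Hi Hw; rewrite -/o /= (pass_nohas HC) /= -E -/F => H.
  have := pass_letter Ho false Hw; have := pass_size Ho false Hw.
  rewrite (pass_nohas HC) /= -E => H1 H2; split=> //.
  by move: H; apply: qreach_mono; nia.
- have E := opres_pass Ho Hw HC; have Ec := count_pass Ho Hw HC.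
  have H1 := pass_letter Ho false Hw; have H2 := pass_size Ho false Hw.
  have H := qreach_full Hi Hw; rewrite -/o /= (pass_has HC) in H.
  set w1 := (pass o false w).2 in E Ec H1 H2 H *.
  have Hn1 : count (oC o) w1 <= n by rewrite -ltnS Ec.
  have [K1 K2 K3] := IH _ H1 Hn1.
  rewrite E -/F in K1 K2 K3; split=> //; first exact: leq_trans K2.
  have := qreach_trans H K3; apply: qreach_mono; rewrite -Ec; nia.
- move/negbT: HC => HC; have E := opres_nohas HC.
  have := qreach_full Hi Hw; rewrite -/o /= (pass_nohas HC) /= -E -/F => H.
  have := pass_letter Ho false Hw; have := pass_size Ho false Hw.
  rewrite (pass_nohas HC) /= -E => H1 H2; split=> //.
  by move: H; apply: qreach_mono; nia.
Qed.

Lemma qreach_ops i w : i <= size ops -> all (letter dl) w ->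
  let w' := foldl (fun v o => opres o v) w (drop i ops) in let F := size w' in
  [/\ all (letter dl) w', size w <= F &
   qreach ((size ops - i) * (F.+1 * (F.+1 * (4 * F + 5))))
     (i, false) (w ++ [:: dl]) (size ops, false) (w' ++ [:: dl])].
Proof.
move=> Hi; have [k Hk] : exists k, size ops - i = k by exists (size ops - i).
elim: k i w Hi Hk => [|k IH] i w Hi Hk Hw.
  have ei : i = size ops by lia.
  rewrite ei drop_size /= subnn; split=> //; exact: qreach0.
have Hi' : i < size ops by lia.
rewrite (drop_nth op_id Hi') /=.
have [K1 K2 K3] := qreach_op Hi' Hw.
set o := nth _ _ _ in K1 K2 K3 *.
have Hk' : size ops - i.+1 = k by lia.
have [J1 J2 J3] := IH i.+1 _ Hi' Hk' K1.
set w' := foldl _ _ _ in J1 J2 J3 *.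
split=> //; first exact: leq_trans J2.
have := qreach_trans K3 J3; apply: qreach_mono.
rewrite Hk' Hk; set F := size (opres o w) in K2 J2 *.
have Hc : count (oC o) w <= size w'.
  by rewrite (leq_trans (count_size _ _)) // (leq_trans K2).
have HF : F.+1 * (4 * F + 5) <= (size w').+1 * (4 * size w' + 5).
  by apply: leq_mul; lia.
by rewrite [k.+1 * _]mulSn leq_add2r; apply: leq_mul.
Qed.

Hypothesis ops_gt0 : 0 < size ops.
Hypothesis op0_noC : forall a, ~~ oC (nth op_id ops 0) a.

(** Waiting behind the end marker, [pre] escapes instruction 0 and ends up in front; by [op0_noC]
    this instruction takes a single sweep. *)
Definition qprog (w : seq nat) : seq nat :=
  foldl (fun v o => opres o v)
    (pre ++ hom (oh (nth op_id ops 0)) (rcons w ys)) (behead ops).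

Lemma start_exec (x : seq bool) : exists L r,
  tm_exec qtm (2 * (size x + size start_word) + 4) (tm_init x) =
  Some (cnf (sRead (0, false)) L (map bit_sym x ++ start_word ++ nseq r 0)).
Proof.
pose t := map bit_sym x.
have Ht : all qsym t.
  by apply/allP=> a /mapP[[] _ ->]; rewrite /qsym /bit_sym; lia.
have Hsw : all qsym start_word.
  move: (letter_qsym pre_letter) ys_letter => /= -> /andP[y0 /ltnW y1].
  by rewrite /qsym y0 y1 leqnn andbT; lia.
have Ei : tm_init x = cnf sStart [::] t by [].
have Hh : head 0 t < dl.+1.
  by move: Ht; case: (t) => [|a t0] //= /andP[/andP[]]; rewrite ltnS.
have := @compile_left _ sStart qstates dl.+1 qdelta _ [::] t _ (head 0 t)
  mem_sStart mem_sLeft Hh erefl.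
move=> /tm_exec1 H1.
have Hc : (0, false) \in controls by rewrite mem_controls.
have Hs : start_word \in suffixes by apply: mem_suffixes; rewrite mem_head.
have := @compile_right _ sStart qstates dl.+1 qdelta _ [::]
  (0 :: head 0 t :: behead t) _ 0 mem_sLeft (mem_sFwd Hc Hs) (ltn0Sn _) erefl.
move=> /tm_exec1 H2.
(* On empty input the scanned blank has become an explicit symbol, hence [r = 1]. *)
have [r0 er0] : exists r, head 0 t :: behead t = t ++ nseq r 0.
  by case: (t) => [|a t0]; [exists 1 | exists 0; rewrite cats0].
have [r H3] := append_exec [::] r0 Hc Hs Ht Hsw.
exists [:: 0], r; rewrite Ei.
rewrite [behead (_ :: _)]/= er0 in H2.
rewrite er0 in H1.
have H12 := tm_exec_add H1 H2.
have H := tm_exec_add H12 H3; rewrite -H.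
congr tm_exec; rewrite /t size_map; move: (size x + _) => k; lia.
Qed.

Lemma read_bits_map y R : read_bits (map bit_sym y ++ dl :: R) = y.
Proof.
elim: y => [|[] y IH] /=; last 2 first.
- by rewrite IH.
- by rewrite IH.
by move: dl_ge; case: dl => [|[|[|d]]].
Qed.

Lemma qtm_computes (x y : seq bool) : qprog (map bit_sym x) = map bit_sym y ->
  exists n c, [/\ n <= (5 * size ops + 18) * ((size y).+1) ^ 3,
    tm_exec qtm n (tm_init x) = Some c, tm_step qtm c = None &
    cfg_output c = y].
Proof.
move=> E; pose t := map bit_sym x; pose o := nth op_id ops 0.
have Ho : op_ok dl o := ops_ok ops_gt0.
have Ht : all (letter dl) (rcons t ys).
  rewrite all_rcons ys_letter; apply/allP=> a /mapP[[] _ ->].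
    by rewrite /letter /bit_sym; lia.
  by rewrite /letter /bit_sym; lia.
have Hnh : ~~ has (oC o) (rcons t ys) by apply/hasPn.
have Hd : all qsym (dl :: pre) by rewrite /= letter_qsym // /qsym leqnn; lia.
have P1 := qreach_pass false ops_gt0 Ht Hd.
have S1 := pass_size Ho false Ht; have L1 := pass_letter Ho false Ht.
rewrite -/o (pass_nohas Hnh) /= in P1 S1 L1.
set h := hom _ _ in P1 S1 L1.
have Hl : all (letter dl) (pre ++ h) by rewrite all_cat pre_letter.
have P2 := qreach_dl false ops_gt0 Hl.
have [J1 J2 J3] := qreach_ops ops_gt0 Hl.
rewrite drop1 -/(qprog t) E in J1 J2 J3.
have P := qreach_trans (qreach_trans P1 P2) J3.
have [L [r S0]] := start_exec x.
have [L' [r' [n [Hn]]]] := P L r.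
rewrite -/t /start_word in S0.
have -> : (rcons t ys ++ dl :: pre) ++ nseq r 0 = t ++ [:: ys, dl & pre] ++ nseq r 0.
  by rewrite cat_rcons -catA.
move=> Ex; exists (2 * (size x + size start_word) + 4 + n).
exists (cnf (sRead (size ops, false)) L' ((map bit_sym y ++ [:: dl]) ++ nseq r' 0)).
split; last 1 first.
- rewrite /conf /cfg_output.
  have -> : forall R : seq nat, R != [::] -> head 0 R :: behead R = R by case.
    by rewrite -catA read_bits_map.
  by case: (y).
- apply: leq_trans (leq_add (leqnn _) Hn) _.
  move: S1 J2; rewrite !size_cat !size_rcons !size_map /=.
  by move=> S1 J2; apply: time_bound.
- exact: tm_exec_add S0 Ex.
- by apply: compile_halt; rewrite ?mem_sRead ?mem_controls //= ltnn.
Qed.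

Lemma qtm_wf : tm_wf qtm.
Proof. by apply: compile_tm_wf => //; apply: leqW. Qed.

End QueueMachine.

(** * Writing the encoding of the game *)

Definition bits (l : seq nat) : seq nat := map bit_sym (flatten (map enc_nat l)).

Lemma bits_cat l1 l2 : bits (l1 ++ l2) = bits l1 ++ bits l2.
Proof. by rewrite /bits map_cat flatten_cat map_cat. Qed.

Lemma bits_cons n l : bits (n :: l) = nseq n 2 ++ 1 :: bits l.
Proof. by rewrite /bits /= map_cat map_rcons map_nseq cat_rcons. Qed.

Lemma mem_bits a l : a \in bits l -> (a == 1) || (a == 2).
Proof. by move=> /mapP[[] _ ->]. Qed.

Lemma hom_id h w : {in w, forall a, h a = [:: a]} -> hom h w = w.
Proof.
elim: w => //= a w IH H; rewrite hom_cons H ?mem_head // IH // => b Hb.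
by apply: H; rewrite inE Hb orbT.
Qed.

Lemma hom_nseq h m a : hom h (nseq m a) = flatten (nseq m (h a)).
Proof. by rewrite /hom map_nseq. Qed.

Lemma iter_hom_id h j w : {in w, forall a, h a = [:: a]} -> iter j (hom h) w = w.
Proof. by move=> H; elim: j => //= j ->; apply: hom_id. Qed.

(* Tape alphabet of the reduction: 1, 2 output bits (false, true); 3, 4 input bits,
   5, 6 the same once counted; 7 a blank cell, 8 a new blank; 9 the initial head;
   10, 11 the R and S nodes; 12, 13 unary counters growing by 1 and 2; 14, 15 the
   lists of edges and of active nodes; 16, 17 unary numbers in these lists; 18 the
   suffix of the word; 19 the end marker. *)
Notation dollar := 19 (only parsing).

Lemma bits_letter l : all (letter dollar) (bits l).
Proof. by apply/allP => a /mem_bits /orP[] /eqP->. Qed.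

Lemma hom_bits h l : h 1 = [:: 1] -> h 2 = [:: 2] -> hom h (bits l) = bits l.
Proof. by move=> H1 H2; apply: hom_id => a /mem_bits/orP[] /eqP->. Qed.

Lemma bits_size_gt0 n l : 0 < size (bits (n :: l)).
Proof. by rewrite bits_cons size_cat /= addnS. Qed.

Definition map_op (h : nat -> seq nat) : op := Op pred0 (fun a => [:: a]) h.

Lemma map_op_ok dl h : (forall a, letter dl a -> all (letter dl) (h a)) ->
  (forall a, letter dl a -> 0 < size (h a)) -> op_ok dl (map_op h).
Proof. by move=> H1 H2; split=> //= a _ _; rewrite has_pred0. Qed.

Lemma opres_map h w : opres (map_op h) w = hom h w.
Proof. by apply: opres_nohas; rewrite has_pred0. Qed.

Definition op_init (sfx : seq nat) : op := map_op
  (fun a => match a with 1 => [:: 3] | 2 => [:: 4] | 18 => sfx | _ => [:: a] end).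

(** Each input symbol triggers one sweep and is marked as counted by adding 2; [op_ren] resets the
    marks. *)
Definition op_mul : op := Op (fun a => (a == 3) || (a == 4))
  (fun a => [:: a.+2]) (fun a => match a with 7 => [:: 7; 8] | _ => [:: a] end).

Definition op_ren : op := map_op
  (fun a => match a with 5 => [:: 3] | 6 => [:: 4] | 8 => [:: 7] | _ => [:: a] end).

(** [9] becomes the extra blank cell, whose S node holds the initial head, already spelled in
    bits. *)
Definition op_tri : op := map_op
  (fun a => match a with
            | 3 => [:: 3; 10; 11] | 4 => [:: 4; 10; 11] | 7 => [:: 7; 10; 11]
            | 9 => [:: 7; 10] ++ bits [:: hSr 0]
            | _ => [:: a] end).

Definition sym_lbl (a : nat) : nat :=
  match a with 3 => lA 1 | 4 => lA 2 | 7 => lA 0 | 10 => lR | _ => lS end.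

(** A sweep that meets a node symbol spells one label, and every sweep extends counters and lists. A
    new entry appears right after [14] or [15]; older ones are larger because [16] and [17] keep
    growing, so the lists come out in increasing order. *)
Definition op_num : op := Op (fun a => a \in [:: 3; 4; 7; 10; 11])
  (fun a => bits [:: sym_lbl a])
  (fun a => match a with
            | 12 => [:: 12; 2] | 13 => [:: 13; 2; 2]
            | 14 => [:: 14; 2; 2; 16; 2; 16; 2; 2; 17]
            | 15 => [:: 15; 2; 2; 16] | 16 => [:: 2; 16] | 17 => [:: 2; 17]
            | _ => [:: a] end).

(** [14] leaves the edge [(0, 1)] and [15] the node 0; [17] closes a number and adds the constant 1,
    the bridge. *)
Definition op_fin : op := map_op
  (fun a => match a with
            | 12 | 13 => [:: 2] | 14 | 17 => [:: 1; 2; 1]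
            | 15 | 16 => [:: 1] | _ => [:: a] end).

Lemma letter_ind (P : nat -> Prop) :
  (forall a, a \in iota 1 18 -> P a) -> forall a, letter dollar a -> P a.
Proof. by move=> H a Ha; apply: H; rewrite mem_iota. Qed.

Ltac letter_cases :=
  apply: letter_ind; rewrite /iota => a; rewrite !inE;
  repeat (case/orP; first by move=> /eqP-> //=); by move=> /eqP-> //=.

Lemma op_init_ok sfx : all (letter dollar) sfx -> 0 < size sfx ->
  op_ok dollar (op_init sfx).
Proof. by move=> H1 H2; apply: map_op_ok; letter_cases. Qed.

Lemma op_mul_ok : op_ok dollar op_mul.
Proof. by split=> //; letter_cases. Qed.

Lemma op_ren_ok : op_ok dollar op_ren.
Proof. by apply: map_op_ok; letter_cases. Qed.

Lemma op_tri_ok : op_ok dollar op_tri.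
Proof.
have H := bits_letter [:: hSr 0].
by apply: map_op_ok; letter_cases.
Qed.

Lemma op_num_ok : op_ok dollar op_num.
Proof.
split; try by letter_cases.
- by move=> a _ _; apply: bits_letter.
- by move=> a _ _; apply: bits_size_gt0.
- by move=> a _ _; apply/hasPn => b /mem_bits/orP[] /eqP->.
- by move=> a _ _; apply: hom_bits.
Qed.

Lemma op_fin_ok : op_ok dollar op_fin.
Proof. by apply: map_op_ok; letter_cases. Qed.

(* The number of nodes, of edges, the edges, the active nodes, the strong nodes and
   the number of labels, before the counters and lists are expanded. *)
Definition head_syms := [:: 2; 12; 1; 13; 1; 14; 12; 1; 15; 12; 1; 15; 2; 12; 1].

Definition prefix_word := head_syms ++ bits [:: lW; lB].

Definition rules_word (R : seq rule) : seq nat :=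
  bits (size R :: flatten (map rule_nats R)).

Definition xsyms (x : seq bool) : seq nat := [seq if b then 4 else 3 | b <- x].

Definition tape_word (R : seq rule) (x : seq bool) (m : nat) : seq nat :=
  prefix_word ++ nseq m 7 ++ [:: 9] ++ xsyms x ++ nseq m 7 ++ rules_word R.

Definition csyms (t : seq nat) : seq nat := flatten [seq [:: c; 10; 11] | c <- t].

Lemma count_bits (C : pred nat) l : ~~ C 1 -> ~~ C 2 -> count C (bits l) = 0.
Proof.
move=> H1 H2; apply/eqP; rewrite eqn0Ngt -has_count -all_predC.
by apply/allP => a /mem_bits/orP[] /eqP->.
Qed.

Definition opphi (o : op) (n a : nat) : seq nat :=
  if oC o a then og o a else iter n (hom (oh o)) [:: a].

Lemma opresE o w n : count (oC o) w = n -> opres o w = hom (opphi o n.+1) w.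
Proof. by move=> <-. Qed.

Lemma opphi_fix o n a : ~~ oC o a -> oh o a = [:: a] -> opphi o n a = [:: a].
Proof.
rewrite /opphi => /negbTE-> H; apply: iter_hom_id => b.
by rewrite inE => /eqP->.
Qed.

Lemma hom_flatten_nseq h m u :
  hom h (flatten (nseq m u)) = flatten (nseq m (hom h u)).
Proof. by elim: m => //= m IH; rewrite hom_cat IH. Qed.

Lemma flatten_nseq (m j a : nat) : flatten (nseq m (nseq j a)) = nseq (m * j) a.
Proof. by elim: m => //= m ->; rewrite mulSn nseqD. Qed.

Lemma hom_pair h a b : hom h [:: a; b] = h a ++ h b.
Proof. by rewrite /hom /= cats0. Qed.

Lemma hom2_cat h k u v :
  hom h (hom k (u ++ v)) = hom h (hom k u) ++ hom h (hom k v).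
Proof. by rewrite !hom_cat. Qed.

(** Both blank blocks start with length one: one [7] comes with the prefix, the other opens the
    suffix. *)
Lemma hom_init R x :
  (prefix_word ++ [:: 7; 9]) ++
    hom (oh (op_init (7 :: rules_word R))) (rcons (map bit_sym x) 18) =
  tape_word R x 1.
Proof.
rewrite -cats1 hom_cat hom1 /tape_word -catA; congr (_ ++ _).
have -> : hom (oh (op_init (7 :: rules_word R))) (map bit_sym x) = xsyms x.
  by elim: x => //= -[] x IH; rewrite hom_cons IH.
by [].
Qed.

Lemma iter_mul j : iter j (hom (oh op_mul)) [:: 7] = 7 :: nseq j 8.
Proof. by elim: j => // j IH; rewrite iterS IH hom_cons hom_id // => a /nseqP[->]. Qed.

(** With [size x] sweeps that meet an input symbol and a last one that does not, every blank gains
    [size x + 1] companions. *)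
Lemma opres_mul R x m : opres op_ren (opres op_mul (tape_word R x m)) =
  tape_word R x (m * (size x).+2).
Proof.
have Ec : count (oC op_mul) (tape_word R x m) = size x.
  have Ex y : count (oC op_mul) (xsyms y) = size y.
    by elim: y => //= -[] y ->.
  by rewrite /tape_word /prefix_word !count_cat Ex !count_nseq /rules_word
    !count_bits //= !mul0n !addn0.
rewrite (opresE Ec); set phi := opphi _ _.
have fixp a : ~~ oC op_mul a -> oh op_mul a = [:: a] -> phi a = [:: a].
  exact: opphi_fix.
have phi7 : phi 7 = 7 :: nseq (size x).+1 8 by apply: iter_mul.
have phib l : hom phi (bits l) = bits l by apply: hom_bits; apply: fixp.
have rb l : hom (oh op_ren) (bits l) = bits l by apply: hom_bits.
have r7 : hom (oh op_ren) (hom phi (nseq m 7)) = nseq (m * (size x).+2) 7.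
  rewrite hom_nseq phi7 hom_flatten_nseq hom_cons hom_nseq (flatten_nseq _ 1).
  by rewrite muln1 (flatten_nseq _ (size x).+2).
have rh : hom (oh op_ren) (hom phi head_syms) = head_syms.
  have -> : hom phi head_syms = head_syms.
    by apply: hom_id => a Ha; apply: fixp; last apply/eqP; move: a Ha; apply/allP.
  by [].
have x34 y : hom (oh op_ren) (hom phi (xsyms y)) = xsyms y.
  by elim: y => //= -[] y IH; rewrite hom_cons hom_cat IH.
rewrite opres_map /tape_word /prefix_word !hom2_cat r7 rh x34 hom1 fixp // hom1
  /rules_word !phib !rb.
by [].
Qed.

Lemma hom_tri R x m : opres op_tri (tape_word R x m) =
  prefix_word ++ csyms (nseq m 7) ++ [:: 7; 10] ++ bits [:: hSr 0] ++
  csyms (xsyms x) ++ csyms (nseq m 7) ++ rules_word R.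
Proof.
rewrite opres_map /tape_word /prefix_word !hom_cat !hom_bits // hom1 -!catA.
have -> : hom (oh op_tri) (xsyms x) = csyms (xsyms x).
  by elim: x => //= -[] x IH; rewrite hom_cons IH.
have -> : hom (oh op_tri) (nseq m 7) = csyms (nseq m 7).
  by elim: m => //= m IH; rewrite hom_cons IH.
by [].
Qed.

Lemma size_cells t : size (cells t) = 3 * size t.
Proof. by elim: t => //= a t ->; lia. Qed.

Lemma zlist_start x m : zlist (start_zipper x m) =
  cells (nseq m 0) ++ [:: lA 0; lR] ++ [:: hSr 0] ++
  cells (map bit_sym x) ++ cells (nseq m 0).
Proof.
have E : rev (lcells (nseq m 0)) = cells (nseq m 0).
  elim: m => // m IH; rewrite -[m.+1]addn1 {2}nseqD {1}addnC nseqD.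
  by rewrite /lcells map_cat flatten_cat rev_cat -/(lcells _) IH /cells map_cat flatten_cat.
by rewrite /zlist /start_zipper /= !rev_cons E -!cats1 -!catA /cells map_cat flatten_cat.
Qed.

(** * Closed forms of the expanded counters and lists *)

Section Num.
Variable T : nat.
Let H := hom (oh op_num).
Let F := hom (oh op_fin).

Lemma fin12 : F (iter T H [:: 12]) = nseq T.+1 2.
Proof.
elim: T => // n IH; rewrite iterSr (iter_hom_cat _ _ [:: 12] [:: 2]) /F hom_cat -/F IH.
rewrite iter_hom_id => [|a]; last by rewrite inE => /eqP->.
by rewrite -[n.+2]addn1 nseqD.
Qed.

Lemma fin13 : F (iter T H [:: 13]) = nseq (2 * T).+1 2.
Proof.
elim: T => // n IH; rewrite iterSr (iter_hom_cat _ _ [:: 13] [:: 2; 2]) /F hom_cat -/F IH.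
rewrite iter_hom_id => [|a]; last by rewrite !inE => /orP[] /eqP->.
have -> : (2 * n.+1).+1 = (2 * n).+1 + 2 by lia.
by rewrite nseqD.
Qed.

Lemma iter2 j : iter j H [:: 2] = [:: 2].
Proof. by rewrite iter_hom_id // => a; rewrite inE => /eqP->. Qed.

Lemma iter16 j : iter j H [:: 16] = rcons (nseq j 2) 16.
Proof.
elim: j => // j IH; rewrite iterSr (iter_hom_cat _ _ [:: 2] [:: 16]) IH.
by rewrite iter2.
Qed.

Lemma iter17 j : iter j H [:: 17] = rcons (nseq j 2) 17.
Proof.
elim: j => // j IH; rewrite iterSr (iter_hom_cat _ _ [:: 2] [:: 17]) IH.
by rewrite iter2.
Qed.

Lemma F2 j : F (nseq j 2) = nseq j 2.
Proof. by apply: hom_id => a /nseqP[->]. Qed.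

(** Splitting off the first sweep isolates the oldest entry, which grows in the remaining [n] sweeps
    to the last node [n + 2]. *)
Lemma fin15 : F (iter T H [:: 15]) = bits (path_active T).
Proof.
elim: T => // n IH.
rewrite iterSr (iter_hom_cat _ _ [:: 15] ([:: 2] ++ [:: 2] ++ [:: 16])) /F hom_cat -/F IH.
rewrite !iter_hom_cat !iter2 iter16 /path_active -[n.+1 in RHS]addn1 iotaD map_cat.
rewrite -cat_cons bits_cat; congr (_ ++ _).
by rewrite -cats1 /F !hom_cat -/F F2 add0n bits_cons.
Qed.

Lemma fin14 :
  F (iter T H [:: 14]) = bits (flatten [seq [:: e.1; e.2] | e <- path_edges T]).
Proof.
elim: T => // n IH.
rewrite iterSr (iter_hom_cat _ _ [:: 14]
  ([:: 2] ++ [:: 2] ++ [:: 16] ++ [:: 2] ++ [:: 16] ++ [:: 2] ++ [:: 2] ++ [:: 17])).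
rewrite /F hom_cat -/F IH.
rewrite !iter_hom_cat !iter2 iter16 iter17 /path_edges -[n.+1 in RHS]addn1 iotaD map_cat.
rewrite flatten_cat -cat_cons map_cat flatten_cat bits_cat; congr (_ ++ _).
by rewrite -!cats1 /F !hom_cat -/F !F2 add0n /= !bits_cons -!catA.
Qed.

End Num.

Lemma size_path_edges T : size (path_edges T) = (2 * T).+1.
Proof.
rewrite /path_edges /=; congr _.+1; rewrite size_flatten /shape -map_comp.
by rewrite -[X in 2 * X](size_iota 0); elim: (iota 0 T) => //= i s ->; lia.
Qed.

Lemma size_path_active T : size (path_active T) = T.+1.
Proof. by rewrite /= size_map size_iota. Qed.

Lemma num_fin R x m :
  opres op_fin (opres op_num (opres op_tri (tape_word R x m))) =
  map bit_sym (enc_game (path_game (zlist (start_zipper x m)) R)).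
Proof.
set l := zlist _; have El : l = _ := zlist_start x m.
pose T := size l.
have Ex y : count (oC op_num) (csyms (xsyms y)) = 3 * size y.
  by elim: y => //= -[] y /= ->; lia.
have Em k : count (oC op_num) (csyms (nseq k 7)) = 3 * k.
  by elim: k => //= k /= ->; lia.
(* The head label is already spelled, so one node is not counted; the final sweep supplies the
   [T]-th growth step. *)
have Ec : count (oC op_num) (opres op_tri (tape_word R x m)) = T.-1.
  rewrite hom_tri /prefix_word !count_cat Ex Em /rules_word !count_bits //=.
  by rewrite /T El !size_cat !size_cells size_map !size_nseq /=; lia.
have ET : T.-1.+1 = T by rewrite /T El !size_cat /=; lia.
rewrite opres_map (opresE Ec) ET hom_tri; set phi := opphi _ _.
have phib s : hom phi (bits s) = bits s by apply: hom_bits; apply: opphi_fix.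
have fb s : hom (oh op_fin) (bits s) = bits s by apply: hom_bits.
have phix y : hom phi (csyms (xsyms y)) = bits (cells (map bit_sym y)).
  elim: y => // b y IH; rewrite [cells _]/= -cat1s.
  rewrite (bits_cat [:: lA (bit_sym b); lR; lS]) -IH.
  rewrite (hom_cat _ [:: if b then 4 else 3; 10; 11]); congr (_ ++ _).
  rewrite hom_cons hom_pair.
  by rewrite (bits_cat [:: _] [:: lR; lS]) (bits_cat [:: _] [:: _]); case: b.
have phim k : hom phi (csyms (nseq k 7)) = bits (cells (nseq k 0)).
  elim: k => // k IH; rewrite [cells _]/=.
  rewrite (bits_cat [:: lA 0; lR; lS]) -IH.
  rewrite (hom_cat _ [:: 7; 10; 11]); congr (_ ++ _).
  by rewrite hom_cons hom_pair (bits_cat [:: _] [:: lR; lS]) (bits_cat [:: _] [:: _]).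
have phiu : hom phi [:: 7; 10] = bits [:: lA 0; lR].
  by rewrite hom_pair (bits_cat [:: _] [:: _]).
have -> : hom phi (prefix_word ++ csyms (nseq m 7) ++ [:: 7; 10] ++ bits [:: hSr 0] ++
    csyms (xsyms x) ++ csyms (nseq m 7) ++ rules_word R) =
    hom phi head_syms ++ bits (lW :: lB :: l) ++ rules_word R.
  rewrite /prefix_word !hom_cat phib phix !phim phiu /rules_word !phib.
  move: (hom phi head_syms) => hh.
  by rewrite (bits_cat [:: lW; lB] l) El !bits_cat -!catA.
rewrite hom_cat hom_cat fb /rules_word fb.
rewrite /enc_game -/(bits _) /game_nats !bits_cat.
have -> : bits (size (glab (path_game l R)) :: glab (path_game l R)) =
   bits [:: T.+2] ++ bits [:: lW, lB & l] by rewrite -bits_cat.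
rewrite !catA; congr (_ ++ _); congr (_ ++ _).
have E12 : hom (oh op_fin) (phi 12) = nseq T.+1 2 := fin12 T.
have E13 : hom (oh op_fin) (phi 13) = nseq (2 * T).+1 2 := fin13 T.
have E14 : hom (oh op_fin) (phi 14) = _ := fin14 T.
have E15 : hom (oh op_fin) (phi 15) = _ := fin15 T.
have p1 : phi 1 = [:: 1] by apply: opphi_fix.
have p2 : phi 2 = [:: 2] by apply: opphi_fix.
rewrite [gN _]/= [gE _]/= [gA _]/= [gS _]/= -/T size_path_edges size_path_active.
rewrite /head_syms !hom_cons p1 p2 !hom_cat E12 E13 E14 E15 !bits_cons.
by rewrite -!catA /= -!catA.
Qed.

(** * The program and the reduction *)

Definition reduction_ops (R : seq rule) (k : nat) : seq op :=
  op_init (7 :: rules_word R) ::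
  flatten (nseq k.+1 [:: op_mul; op_ren]) ++ [:: op_tri; op_num; op_fin].

Lemma Forall_nth (T : Type) (P : T -> Prop) x0 s i :
  List.Forall P s -> i < size s -> P (nth x0 s i).
Proof.
move=> H; elim: H i => //= x s' Px _ IH [|i] //=; rewrite ltnS; exact: IH.
Qed.

Lemma reduction_ops_ok R k : List.Forall (op_ok dollar) (reduction_ops R k).
Proof.
constructor.
  by apply: op_init_ok => //=; apply: bits_letter.
elim: k.+1 => [|j IH] /=.
  exact: List.Forall_cons op_tri_ok (List.Forall_cons _ op_num_ok
    (List.Forall_cons _ op_fin_ok (List.Forall_nil _))).
exact: List.Forall_cons op_mul_ok (List.Forall_cons _ op_ren_ok IH).
Qed.

(** What [k.+1] multiplications make of a single blank; it dominates the space bound [n ^ k + k]. *)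
Definition blanks (k n : nat) : nat := n.+2 ^ k.+1.

Definition reduction (M : TM) (k : nat) (x : seq bool) : game :=
  path_game (zlist (start_zipper x (blanks k (size x)))) (tm_rules M).

Lemma reduction_prog M k x :
  qprog (reduction_ops (tm_rules M) k) (prefix_word ++ [:: 7; 9]) 18
    (map bit_sym x) = map bit_sym (enc_game (reduction M k x)).
Proof.
have mulE R m j : foldl (fun v o => opres o v) (tape_word R x m)
    (flatten (nseq j [:: op_mul; op_ren])) = tape_word R x (m * (size x).+2 ^ j).
  elim: j m => [|j IH] m; first by rewrite muln1.
  by rewrite [LHS]/= opres_mul IH expnS mulnA.
rewrite /qprog [nth _ _ _]/= hom_init /reduction_ops /behead foldl_cat mulE.
by rewrite mul1n [LHS]/= num_fin.
Qed.

(** * Polynomial bounds *)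

Definition polyb (g : nat -> nat) := exists c d, forall n, g n <= c * n.+1 ^ d.

Lemma polyb_const c : polyb (fun=> c).
Proof. by exists c, 0 => n; rewrite expn0 muln1. Qed.

Lemma polyb_id : polyb id.
Proof. by exists 1, 1 => n; rewrite expn1 mul1n. Qed.

Lemma polybD f g : polyb f -> polyb g -> polyb (fun n => f n + g n).
Proof.
move=> [c [d Hf]] [c' [d' Hg]]; exists (c + c'), (d + d') => n.
have E e e' : n.+1 ^ e <= n.+1 ^ (e + e').
  by rewrite expnD leq_pmulr // expn_gt0.
rewrite mulnDl leq_add //; first by rewrite (leq_trans (Hf n)) // leq_mul.
by rewrite (leq_trans (Hg n)) // addnC leq_mul.
Qed.

Lemma polybM f g : polyb f -> polyb g -> polyb (fun n => f n * g n).
Proof.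
move=> [c [d Hf]] [c' [d' Hg]]; exists (c * c'), (d + d') => n.
by rewrite expnD mulnACA leq_mul.
Qed.

Lemma polybX f d : polyb f -> polyb (fun n => f n ^ d).
Proof.
move=> [c [e Hf]]; exists (c ^ d), (e * d) => n.
by rewrite expnM -expnMn; case: d => // d; rewrite leq_exp2r.
Qed.

Lemma polyb_le f g : (forall n, f n <= g n) -> polyb g -> polyb f.
Proof. by move=> H [c [d Hg]]; exists c, d => n; apply: leq_trans (Hg n). Qed.

Lemma polyb_bound g : polyb g -> exists K, forall n, g n <= n ^ K + K.
Proof.
(* The exponent [c + 2 * d] serves [n >= 2], where [c <= n ^ c] and [n + 1 <= n ^ 2]; the summand
   [c * 2 ^ d] covers [n <= 1]. *)
move=> [c [d H]]; exists (c + 2 * d + c * 2 ^ d) => n.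
apply: leq_trans (H n) _.
have [n1|n2] := leqP n 1.
  apply: leq_trans (leq_addl _ _); apply: leq_trans (leq_addl _ _).
  by apply: leq_mul => //; case: (d) => // e; rewrite leq_exp2r.
apply: leq_trans (leq_addr _ _).
have B1 : c <= n ^ c by rewrite ltnW // ltn_expl.
have B2 : n.+1 ^ d <= n ^ (2 * d).
  rewrite expnM; case: (d) => // e; rewrite leq_exp2r //; nia.
apply: leq_trans (leq_mul B1 B2) _; rewrite -expnD leq_exp2l // leq_addr //.
Qed.

Lemma size_bits l : size (bits l) = size (flatten (map enc_nat l)).
Proof. by rewrite size_map. Qed.

Lemma size_bits_le B l : all (fun n => n <= B) l -> size (bits l) <= size l * B.+1.
Proof.
elim: l => //= n l IH /andP[Hn Hl].
rewrite bits_cons size_cat size_nseq /= addnS -addSn mulSn.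
by rewrite leq_add // IH.
Qed.

(** Apart from labels and rules there are [6 * T + 9] numbers, each at most [2 * T + 2], so the
    unary encoding stays polynomial once labels are bounded. *)
Lemma size_enc_path l R B : all (fun n => n <= B) [:: lW, lB & l] ->
  size (enc_game (path_game l R)) <=
  (6 * size l + 9) * (2 * size l + 3) + (size l + 2) * B.+1 +
  size (rules_word R).
Proof.
set T := size l; move=> HB; rewrite /enc_game -size_bits.
set s2 := flatten [seq [:: e.1; e.2] | e <- path_edges T].
pose A := [:: T.+2; (2 * T).+1] ++ s2 ++ (T.+1 :: path_active T) ++
  (T.+1 :: path_active T) ++ [:: T.+2].
have -> : game_nats (path_game l R) =
    A ++ [:: lW, lB & l] ++ (size R :: flatten (map rule_nats R)).
  rewrite /game_nats [size (gE _)]size_path_edges.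
  by rewrite [size (gA _)]size_path_active /A -!catA.
rewrite (bits_cat A) (bits_cat [:: lW, lB & l] (_ :: _)) size_cat size_cat.
rewrite addnA leq_add2r.
apply: leq_add; last first.
  by apply: leq_trans (size_bits_le HB) _; rewrite /= addn2.
have s2E : size s2 = 2 * (2 * T).+1.
  by rewrite /s2 -size_path_edges; elim: (path_edges T) => //= e s ->; lia.
have Hs2 : all (fun n => n <= 2 * T + 2) s2.
  by apply/allP => n /flatten_mapP[[u v]]; rewrite (mem_path_edges T u v) !inE /=; lia.
have HA : all (fun n => n <= 2 * T + 2) (path_active T).
  by apply/allP => n; rewrite mem_path_active; lia.
have sA : size A = 6 * T + 9.
  rewrite /A; clearbody s2.
  by rewrite !size_cat s2E /= !size_map !size_iota; lia.
rewrite -sA (addnS _ 2); apply: size_bits_le.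
rewrite /A; clearbody s2; rewrite !all_cat Hs2.
by move: HA => /= ->; lia.
Qed.

Definition label_bound := lW + lB + lR + lS + lA 0 + lA 1 + lA 2 + hSr 0.

Lemma start_zipper_labels x m :
  all (fun n => n <= label_bound) [:: lW, lB & zlist (start_zipper x m)].
Proof.
pose B := label_bound.
have H a : a <= 2 -> lA a <= B.
  by case: a => [|[|[|a]]] // _; rewrite /B /label_bound; lia.
have [HR HS] : lR <= B /\ lS <= B by rewrite /B /label_bound; lia.
have Hc t : all (fun a => a <= 2) t -> all (fun n => n <= B) (cells t).
  by elim: t => //= a t IH /andP[Ha /IH->]; rewrite H // HR HS.
have H0 : all (fun a => a <= 2) (nseq m 0) by rewrite all_nseq orbT.
have Hx : all (fun a => a <= 2) (map bit_sym x) by apply/allP => a /mapP[[] _ ->].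
rewrite zlist_start -[[:: lW, lB & _]]/([:: lW; lB] ++ _) !all_cat !Hc //.
by rewrite /= HR H // /B /label_bound; lia.
Qed.

Lemma size_start_zipper x m :
  size (zlist (start_zipper x m)) = 3 * (2 * m + size x + 1).
Proof.
by rewrite zlist_start !size_cat !size_cells !size_nseq size_map /=; lia.
Qed.

Lemma reduction_poly_time M k : poly_time (fun x => enc_game (reduction M k x)).
Proof.
pose R := tm_rules M; pose ops := reduction_ops R k.
pose T n := 3 * (2 * blanks k n + n + 1).
pose S n := (6 * T n + 9) * (2 * T n + 3) + (T n + 2) * label_bound.+1 +
  size (rules_word R).
have PT : polyb T.
  apply: polybM (polyb_const 3) _; apply: polybD _ (polyb_const 1).
  apply: polybD _ polyb_id; apply: polybM (polyb_const 2) _.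
  apply: polybX; apply: polyb_le (polybD polyb_id (polyb_const 2)) => n.
  by rewrite addn2.
have PS : polyb S.
  have PC := polyb_const; repeat (apply: polybD || apply: polybM) => //.
have [K HK] : exists K, forall n, (5 * size ops + 18) * (S n).+1 ^ 3 <= n ^ K + K.
  apply: polyb_bound; apply: polybM (polyb_const _) _; apply: polybX.
  by apply: polyb_le (polybD PS (polyb_const 1)) => n; rewrite addn1.
have ok := reduction_ops_ok R k.
have pre_ok : all (letter dollar) (prefix_word ++ [:: 7; 9]).
  by rewrite /prefix_word !all_cat bits_letter.
exists (qtm dollar ops (prefix_word ++ [:: 7; 9]) 18); split; first exact: qtm_wf.
exists K => x.
have ok_nth i : i < size ops -> op_ok dollar (nth op_id ops i).
  exact: Forall_nth.
have [n [c [Hn E1 E2 E3]]] := qtm_computes (dl := dollar) (ops := ops) (ys := 18)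
  isT isT pre_ok ok_nth isT (fun=> isT) (reduction_prog M k x).
exists n, c; split=> //; apply: leq_trans Hn _; apply: leq_trans (HK (size x)).
apply: leq_mul => //; rewrite leq_exp2r // ltnS.
apply: leq_trans (size_enc_path _ (start_zipper_labels _ _)) _.
by rewrite size_start_zipper.
Qed.

Lemma blanks_bound k n : n ^ k + k <= blanks k n.
Proof.
(* Of the [n + 2] copies of [n.+2 ^ k], one dominates [n ^ k] and another dominates [k], through
   [k < 2 ^ k]. *)
rewrite /blanks expnS mulSn mulSn addnA.
apply: leq_trans (leq_addr _ _); apply: leq_add.
  by case: k => // k; rewrite leq_exp2r // ltnW.
apply: leq_trans (ltnW (ltn_expl k (isT : 1 < 2))) _.
by case: k => // k; rewrite leq_exp2r.
Qed.

Theorem mainTheorem9 : PSPACE_hard constructor_wins dr_promise.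
Proof.
move=> L [M [Hwf [k HM]]].
exists (reduction M k); split; first exact: reduction_poly_time.
move=> x; have [_ ns3 _] := Hwf.
have ns0 : 0 < tm_ns M by apply: leq_trans ns3.
set m := blanks k (size x).
have Hz := start_zipper_ok x m; have HR := tm_rules_ok ns0.
split.
  split; first exact: path_game_wf.
  exact: inv_not_connected (inv_init _ Hz) _.
have [n [c [Hex Hst HL Hsp]]] := HM x.
have Hrun : zrun (tm_rules M) (start_zipper x m) (tm_acc M (cfg_state c)).
  apply: start_zipper_run Hex Hst _ => // i c' Hi Hc.
  exact: leq_trans (Hsp _ _ Hi Hc) (blanks_bound _ _).
rewrite -HL; case: (tm_acc M (cfg_state c)) Hrun => Hrun; split=> //.
  by move=> _; apply: zrun_true_wins.
by move/(zrun_false_loses HR Hz Hrun).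
Qed.
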